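(* Let $n\geq 3$, let $R=\Pi_{\widetilde{A_{n-1}}}$ be the preprojective algebra of extended Dynkin type $\widetilde{A_{n-1}}$ over $\Bbbk$, and let $G$ be a subgroup of the dihedral group $D_n$ acting on $R$ by graded automorphisms. The Auslander map $\eta_{R,G}:R\#G\to \mathrm{End}_{R^G}R$ is an isomorphism if and only if there exists a reflection $\tau\in D_n$ that fixes a vertex (i.e. $\tau(e_i)=e_i$ for some $i$) and such that $\tau\notin G$.
   Context: $\Bbbk$ is an algebraically closed field of characteristic zero. Preprojective algebra: for $n\geq 3$, let $\overline{Q}$ be the quiver with vertices $e_0,\dots,e_{n-1}$ and, for each $i=0,\dots,n-1$ (all indices mod $n$), one nonstar arrow $\alpha_i$ from $e_i$ to $e_{i+1}$ and one star arrow $\alpha_i^*$ from $e_{i+1}$ to $e_i$. This is the double of the quiver $Q=\widetilde{A_{n-1}}$ whose arrows are the $\alpha_i$. In the path algebra $\Bbbk\overline{Q}$, paths are composed left to right ($pq$ is concatenation if the target of $p$ is the source of $q$, and $0$ otherwise), and the $e_i$ are the trivial paths. Set $\Omega=\sum_{i=0}^{n-1}(\alpha_i\alpha_i^*-\alpha_i^*\alpha_i)$ and $R=\Pi_{\widetilde{A_{n-1}}}=\Bbbk\overline{Q}/(\Omega)$, graded by path length. Dihedral action: $D_n$ is identified with the group of graded automorphisms of $R$ generated by $\rho$ and $r$, where $\rho(e_i)=e_{i+1}$, $\rho(\alpha_i)=\alpha_{i+1}$, $\rho(\alpha_i^* )=\alpha_{i+1}^*$, and $r(e_i)=e_{n-i}$,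 $r(\alpha_i)=\alpha_{n-i-1}^*$, $r(\alpha_i^* )=\alpha_{n-i-1}$ (indices mod $n$). This group is isomorphic to the dihedral group of order $2n$; its reflections are the elements $\rho^j r$. Auslander map: for an algebra $R$ and a finite group $G$ of automorphisms of $R$, the skew group ring $R\#G$ consists of formal sums $\sum_{g\in G} a_g\#g$ with $a_g\in R$ and multiplication $(a\#g)(b\#h)=a\,g(b)\#gh$. $R^G$ is the fixed ring, $R$ is regarded as a right $R^G$-module, and $\eta_{R,G}:R\#G\to\mathrm{End}_{R^G}R$ is the algebra map sending $a\#g$ to the endomorphism $b\mapsto a\,g(b)$. *)

(* Defs.v *)
From HB Require Import structures.
From mathcomp Require Import all_boot all_fingroup all_algebra.
From mathcomp Require Import finmap monalg.
From mathcomp Require Import boolp functions.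

Set Implicit Arguments.
Unset Strict Implicit.
Unset Printing Implicit Defensive.

Import GRing.Theory.
Local Open Scope ring_scope.
Local Open Scope quotient_scope.

(* [vertex_pt] only records that there is a vertex, so that 1 != 0 in the path
   algebra. *)
Record quiver := Quiver {
  vertex : finType;
  arrow : finType;
  source : arrow -> vertex;
  target : arrow -> vertex;
  vertex_pt : vertex
}.

Section Paths.
Variable Q : quiver.
Implicit Types (v : vertex Q) (s : seq (arrow Q)).

Fixpoint walk v s : bool :=
  if s is a :: s' then (source a == v) && walk (target a) s' else true.

Fixpoint walk_end v s : vertex Q :=
  if s is a :: s' then walk_end (target a) s' else v.

Record qpath := QPath {
  path_data : vertex Q * seq (arrow Q);
  path_walk : walk path_data.1 path_data.2
}.

HB.instance Definition _ := [isSub for path_data].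
HB.instance Definition _ := [Choice of qpath by <:].

Definition path_source (p : qpath) : vertex Q := (path_data p).1.
Definition path_arrows (p : qpath) : seq (arrow Q) := (path_data p).2.
Definition path_target (p : qpath) : vertex Q :=
  walk_end (path_source p) (path_arrows p).

Definition triv_path v : qpath := @QPath (v, [::]) isT.

Lemma arrow_walk a : walk (source a) [:: a].
Proof. by rewrite /= eqxx. Qed.

Definition arrow_path (a : arrow Q) : qpath :=
  @QPath (source a, [:: a]) (arrow_walk a).

(* [None] stands for the zero product. *)
Definition path_concat (p q : qpath) : option qpath :=
  if path_target p == path_source q
  then insub (path_source p, path_arrows p ++ path_arrows q) else None.

Lemma walk_cat v s1 s2 :
  walk v (s1 ++ s2) = walk v s1 && walk (walk_end v s1) s2.
Proof. by elim: s1 v => //= a s IH v; rewrite IH andbA. Qed.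

Lemma walk_end_cat v s1 s2 :
  walk_end v (s1 ++ s2) = walk_end (walk_end v s1) s2.
Proof. by elim: s1 v => //= a s IH v. Qed.

Variant concat_spec (p q : qpath) : option qpath -> Type :=
| ConcatSome r of path_target p = path_source q
    & path_source r = path_source p
    & path_arrows r = path_arrows p ++ path_arrows q
    & path_target r = path_target q : concat_spec p q (Some r)
| ConcatNone of path_target p != path_source q : concat_spec p q None.

Lemma path_concatP p q : concat_spec p q (path_concat p q).
Proof.
rewrite /path_concat; case: eqP => [e|/eqP e]; last by constructor.
case: insubP => [r _ er|/=].
  have es : path_source r = path_source p by rewrite /path_source er.
  have ea : path_arrows r = path_arrows p ++ path_arrows q.
    by rewrite /path_arrows er.
  constructor=> //; rewrite /path_target es ea walk_end_cat.
  by rewrite -/(path_target p) e.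
rewrite walk_cat -/(path_target p) e.
by rewrite (path_walk p) (path_walk q).
Qed.

Lemma qpath_eq (p q : qpath) :
  path_source p = path_source q -> path_arrows p = path_arrows q -> p = q.
Proof.
move=> e1 e2; apply: val_inj => /=.
rewrite [LHS]surjective_pairing [RHS]surjective_pairing.
by rewrite -/(path_source p) -/(path_arrows p) e1 e2.
Qed.

Lemma concatA p q r :
  obind (fun t => path_concat t r) (path_concat p q) =
  obind (path_concat p) (path_concat q r).
Proof.
case: (path_concatP p q) => [t e1 e2 e3 e4|n1] /=;
  case: (path_concatP q r) => [u f1 f2 f3 f4|n2] //=.
- case: (path_concatP t r) => [w g1 g2 g3 g4|].
    case: (path_concatP p u) => [w' h1 h2 h3 h4|].
      congr Some; apply: qpath_eq; first by rewrite g2 e2 h2.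
      by rewrite g3 e3 h3 f3 catA.
    by rewrite f2 e1 eqxx.
  by rewrite e4 f1 eqxx.
- by case: (path_concatP t r) => // w; rewrite e4 => g; rewrite g eqxx in n2.
- by case: (path_concatP p u) => // w; rewrite f2 => g; rewrite g eqxx in n1.
Qed.

Lemma concat_trivl v p :
  path_concat (triv_path v) p = if v == path_source p then Some p else None.
Proof.
case: (path_concatP (triv_path v) p) => [r e1 e2 e3 e4|/negPf ne]; last first.
  by rewrite ifF.
rewrite (_ : v = path_source p) // eqxx; congr Some; apply: qpath_eq => //.
by rewrite e2 -[RHS]e1.
Qed.

Lemma concat_trivr v p :
  path_concat p (triv_path v) = if path_target p == v then Some p else None.
Proof.
case: (path_concatP p (triv_path v)) => [r e1 e2 e3 e4|/negPf ne].
  rewrite (_ : path_target p = v) // eqxx; congr Some; apply: qpath_eq => //.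
  by rewrite e3 cats0.
by rewrite ifF.
Qed.

End Paths.

Arguments path_source {Q}.
Arguments path_arrows {Q}.
Arguments path_target {Q}.

Section LinearExtension.
Variables (k : nzRingType) (K : choiceType) (V : lmodType k) (h : K -> V).

Definition lext (f : {malg k[K]}) : V := \sum_(p <- msupp f) f@_p *: h p.

Lemma lextw (d : {fset K}) (f : {malg k[K]}) :
  (msupp f `<=` d)%fset -> lext f = \sum_(p <- d) f@_p *: h p.
Proof.
move=> le; rewrite /lext (big_fset_incl _ le) //= => p _ /mcoeff_outdom ->.
by rewrite scale0r.
Qed.

Lemma lext_linear : linear lext.
Proof.
move=> a f g; pose d := (msupp f `|` msupp g)%fset.
have lf : (msupp f `<=` d)%fset by apply: fsubsetUl.
have lg : (msupp g `<=` d)%fset by apply: fsubsetUr.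
have lfg : (msupp (a *: f + g)%R `<=` d)%fset.
  apply: fsubset_trans (msuppD_le _ _) _; apply: fsetSU; exact: msuppZ_le.
rewrite (lextw lf) (lextw lg) (lextw lfg) scaler_sumr -big_split /=.
by apply: eq_bigr => p _; rewrite mcoeffD mcoeffZ scalerDl scalerA.
Qed.

HB.instance Definition _ :=
  GRing.isLinear.Build k {malg k[K]} V *:%R lext lext_linear.

Lemma lextU p : lext << p >> = h p.
Proof.
by rewrite (lextw msuppU_le) big_seq_fset1 mcoeffUU scale1r.
Qed.

End LinearExtension.

Lemma lext_unique (k : nzRingType) (K : choiceType) (V : lmodType k)
    (F : {linear {malg k[K]} -> V}) (f : {malg k[K]}) :
  F f = lext (fun p => F << p >>) f.
Proof.
rewrite {1}[f]monalgE linear_sum; apply: eq_bigr => p _ /=.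
rewrite -linearZ /=; congr (F _); apply/malgP => q.
by rewrite mcoeffZ !mcoeffU mulrnAr mulr1.
Qed.

(* The k-vector space on the set of paths; as [qpath Q] is only a [choiceType],
   [malg] supplies no product and the one below is the only one in scope. *)
Definition path_algebra (k : fieldType) (Q : quiver) := {malg k[qpath Q]}.

HB.instance Definition _ (k : fieldType) (Q : quiver) :=
  GRing.Lmodule.on (path_algebra k Q).

HB.lock Definition path_elt (k : fieldType) (Q : quiver) (p : qpath Q) :
  path_algebra k Q := << p >>.

Arguments path_elt {k Q}.

Definition path_mul (k : fieldType) (Q : quiver) (p q : qpath Q) :
    path_algebra k Q :=
  if path_concat p q is Some r then path_elt r else 0.

Arguments path_mul {k Q}.

HB.lock Definition pa_mul (k : fieldType) (Q : quiver) (f g : path_algebra k Q) :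
  path_algebra k Q := lext (fun p => lext (path_mul p) g) f.

Section PathAlgebra.
Variables (k : fieldType) (Q : quiver).
Local Notation path_algebra := (path_algebra k Q).
Local Notation pa_mul := (@pa_mul k Q).
Implicit Types f g : path_algebra.

Definition pa_one : path_algebra := \sum_(v : vertex Q) path_elt (triv_path v).

Lemma pa_mulDl : left_distributive pa_mul +%R.
Proof. by move=> f g h; rewrite pa_mul.unlock linearD. Qed.

Lemma pa_mulZl c f g : pa_mul (c *: f) g = c *: pa_mul f g.
Proof. by rewrite pa_mul.unlock linearZ. Qed.

Lemma pa_mul_linr f : linear (pa_mul f).
Proof.
move=> c g h; rewrite pa_mul.unlock /lext scaler_sumr -big_split /=.
apply: eq_bigr => p _; rewrite -!/(lext _ _) linearP /= scalerDr.
by rewrite !scalerA mulrC.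
Qed.

HB.instance Definition _ f :=
  GRing.isLinear.Build k path_algebra path_algebra *:%R (pa_mul f)
    (@pa_mul_linr f).

Lemma pa_mulUU p q : pa_mul (path_elt p) (path_elt q) = path_mul p q.
Proof. by rewrite pa_mul.unlock path_elt.unlock !lextU. Qed.

Lemma pa_mul0l g : pa_mul 0 g = 0.
Proof. by rewrite pa_mul.unlock linear0. Qed.

Lemma pa_mul0r f : pa_mul f 0 = 0. Proof. exact: linear0. Qed.

Lemma pa_mulDr : right_distributive pa_mul +%R.
Proof. by move=> f g h; exact: linearD. Qed.

Lemma pa_mulZr c f g : pa_mul f (c *: g) = c *: pa_mul f g.
Proof. exact: linearZ. Qed.

Lemma pa_ind (P : path_algebra -> Prop) :
  (forall c f g, P f -> P g -> P (c *: f + g)) -> P 0 ->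
  (forall p, P (path_elt p)) -> forall f, P f.
Proof.
rewrite path_elt.unlock => Plin P0 PU f.
have -> : f = lext (fun p => << p >>) f.
  exact: (lext_unique (idfun : {linear {malg k[qpath Q]} -> _})).
rewrite /lext.
elim/big_ind: _ => // [x y Px Py|p _].
  by rewrite -[x]scale1r; apply: Plin.
by rewrite -[_ *: _]addr0; apply: Plin.
Qed.

Lemma pa_mulA : associative pa_mul.
Proof.
move=> f g h; elim/pa_ind: f => [c f f' IH IH'||p].
- by rewrite !pa_mulDl !pa_mulZl IH IH'.
- by rewrite !pa_mul0l.
elim/pa_ind: g => [c f f' IH IH'||q].
- by rewrite pa_mulDl pa_mulZl pa_mulDr pa_mulZr pa_mulDr pa_mulZr pa_mulDl
    pa_mulZl IH IH'.
- by rewrite pa_mul0l !pa_mul0r pa_mul0l.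
elim/pa_ind: h => [c f f' IH IH'||r].
- by rewrite !pa_mulDr !pa_mulZr IH IH'.
- by rewrite !pa_mul0r.
rewrite !pa_mulUU /path_mul; have := concatA p q r.
case: (path_concat p q) => [t|]; case: (path_concat q r) => [u|] /= E.
- by rewrite !pa_mulUU /path_mul E.
- by rewrite pa_mul0r pa_mulUU /path_mul E.
- by rewrite pa_mul0l pa_mulUU /path_mul -E.
- by rewrite pa_mul0l pa_mul0r.
Qed.

Lemma pa_mul1l : left_id pa_one pa_mul.
Proof.
elim/pa_ind => [c f g IH IH'||p].
- by rewrite pa_mulDr pa_mulZr IH IH'.
- exact: pa_mul0r.
rewrite /pa_one (big_morph (fun x => pa_mul x _) (fun _ _ => pa_mulDl _ _ _)
  (pa_mul0l _)).
rewrite (bigD1 (path_source p)) //= pa_mulUU /path_mul concat_trivl eqxx.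
rewrite big1 ?addr0 // => v /negPf nv.
by rewrite pa_mulUU /path_mul concat_trivl nv.
Qed.

Lemma pa_mul1r : right_id pa_one pa_mul.
Proof.
elim/pa_ind => [c f g IH IH'||p].
- by rewrite pa_mulDl pa_mulZl IH IH'.
- exact: pa_mul0l.
rewrite /pa_one (big_morph (pa_mul _) (fun _ _ => pa_mulDr _ _ _) (pa_mul0r _)).
rewrite (bigD1 (path_target p)) //= pa_mulUU /path_mul.
rewrite concat_trivr eqxx big1 ?addr0 // => v /negPf nv.
by rewrite pa_mulUU /path_mul concat_trivr eq_sym nv.
Qed.

Lemma pa_one_triv v : pa_one@_(triv_path v) = 1.
Proof.
have eltE w : (path_elt (triv_path w))@_(triv_path v)
    = (triv_path w == triv_path v)%:R :> k.
  by rewrite path_elt.unlock mcoeffU.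
rewrite /pa_one raddf_sum /= (bigD1 v) //= eltE eqxx.
rewrite big1 ?addr0 // => w nw; rewrite eltE;
case: eqP => // /(congr1 path_source) /= e.
by rewrite -[w]/(path_source (triv_path w)) e eqxx in nw.
Qed.

Lemma pa_one_neq0 : pa_one != 0.
Proof.
apply/eqP => /(congr1 (mcoeff (triv_path (vertex_pt Q)))).
by rewrite pa_one_triv mcoeff0 => /eqP; rewrite oner_eq0.
Qed.

HB.instance Definition _ := GRing.Zmodule_isNzRing.Build path_algebra
  pa_mulA pa_mul1l pa_mul1r pa_mulDl pa_mulDr pa_one_neq0.

Lemma pa_scalerAl c (f g : path_algebra) : c *: (f * g) = (c *: f) * g.
Proof. by rewrite -[RHS]/(pa_mul (c *: f) g) pa_mulZl. Qed.

HB.instance Definition _ :=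
  GRing.Lmodule_isLalgebra.Build k path_algebra pa_scalerAl.

Lemma pa_scalerAr c (f g : path_algebra) : c *: (f * g) = f * (c *: g).
Proof. by rewrite -[RHS]/(pa_mul f (c *: g)) pa_mulZr. Qed.

HB.instance Definition _ :=
  GRing.Lalgebra_isAlgebra.Build k path_algebra pa_scalerAr.

Lemma path_eltM p q : path_elt p * path_elt q = path_mul p q.
Proof. exact: pa_mulUU. Qed.

Lemma mcoeff_triv_mul v (f g : path_algebra) :
  (f * g)@_(triv_path v) = f@_(triv_path v) * g@_(triv_path v).
Proof.
have cfP c (x y : path_algebra) :
  (c *: x + y)@_(triv_path v) = c * x@_(triv_path v) + y@_(triv_path v).
  by rewrite mcoeffD mcoeffZ.
elim/pa_ind: f => [c f f' IH IH'||p].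
- rewrite mulrDl -scalerAl (cfP c (f * g) (f' * g)) (cfP c f f') IH IH'.
  by rewrite mulrDl mulrA.
- by rewrite mul0r !mcoeff0 mul0r.
elim/pa_ind: g => [c f f' IH IH'||q].
- rewrite mulrDr -scalerAr (cfP c (path_elt p * f) (path_elt p * f')) (cfP c f f').
  by rewrite IH IH' mulrDr mulrCA.
- by rewrite mulr0 !mcoeff0 mulr0.
have eltE r : (path_elt r)@_(triv_path v) = (r == triv_path v)%:R :> k.
  by rewrite path_elt.unlock mcoeffU.
rewrite path_eltM /path_mul !eltE.
case: (path_concatP p q) => [r e1 e2 e3 e4|ne]; rewrite ?eltE ?mcoeff0.
  case: (altP (r =P _)) => [er|nr].
    have := e3; rewrite er /path_arrows /=.
    case Ep: (path_data p) => [s [|//]] /=; case Eq: (path_data q) => [t [|//]] _.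
    have ep : p = triv_path v.
      by apply: qpath_eq; rewrite -?e2 ?er // /path_arrows Ep.
    have eq : q = triv_path v.
      apply: qpath_eq; last by rewrite /path_arrows Eq.
      by rewrite -e1 ep.
    by rewrite ep eq eqxx mulr1.
  case: eqP => [ep|]; last by rewrite mul0r.
  case: eqP => [eq|]; last by rewrite mulr0.
  case/eqP: nr; apply: qpath_eq; first by rewrite e2 ep.
  by rewrite e3 ep eq.
case: eqP => [ep|]; last by rewrite mul0r.
case: eqP => [eq|]; last by rewrite mulr0.
by case/eqP: ne; rewrite ep eq.
Qed.

End PathAlgebra.

Record ideal2 (A : nzRingType) := Ideal2 {
  ideal_mem :> {pred A};
  ideal_zmod : zmod_closed ideal_mem;
  ideal_mull : forall a x, x \in ideal_mem -> a * x \in ideal_mem;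
  ideal_mulr : forall a x, x \in ideal_mem -> x * a \in ideal_mem;
  ideal_proper : 1 \notin ideal_mem
}.

HB.instance Definition _ (A : nzRingType) (I : ideal2 A) :=
  GRing.isZmodClosed.Build A (ideal_mem I) (ideal_zmod I).

Section QuotientAlgebra.
Variables (k : fieldType) (A : algType k) (I : ideal2 A).

Definition quot_alg := {ideal_quot (ideal_mem I)}.

HB.instance Definition _ := GRing.Zmodule.on quot_alg.

Definition qpi (x : A) : quot_alg := \pi_({ideal_quot (ideal_mem I)}) x.
Definition qrepr (x : quot_alg) : A :=
  generic_quotient.repr (x : {ideal_quot (ideal_mem I)}).

Lemma qreprK x : qpi (qrepr x) = x. Proof. exact: reprK. Qed.

Lemma qpi_eq x y : (qpi x = qpi y) <-> (x - y \in ideal_mem I).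
Proof. by rewrite Quotient.idealrBE; split=> [/eqP|/eqP]. Qed.

Lemma qpi_eq0 x : x \in ideal_mem I -> qpi x = 0.
Proof.
move=> xI; have -> : 0 = qpi 0 by rewrite /qpi raddf0.
by apply/qpi_eq; rewrite subr0.
Qed.

Lemma qreprB x : x - qrepr (qpi x) \in ideal_mem I.
Proof. by apply/qpi_eq; rewrite qreprK. Qed.

Lemma qpiB : zmod_morphism qpi. Proof. by move=> x y; exact: raddfB. Qed.
HB.instance Definition _ := GRing.isZmodMorphism.Build A quot_alg qpi qpiB.

Definition q_mul (x y : quot_alg) : quot_alg := qpi (qrepr x * qrepr y).
Definition q_scale (c : k) (x : quot_alg) : quot_alg := qpi (c *: qrepr x).

Lemma qpi_mul x y : q_mul (qpi x) (qpi y) = qpi (x * y).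
Proof.
apply/esym/qpi_eq; set x' := qrepr _; set y' := qrepr _.
have -> : x * y - x' * y' = (x - x') * y + x' * (y - y').
  by rewrite mulrBl mulrBr addrA subrK.
apply: rpredD; [apply: ideal_mulr | apply: ideal_mull]; exact: qreprB.
Qed.

Lemma qpi_scale c x : q_scale c (qpi x) = qpi (c *: x).
Proof.
apply/esym/qpi_eq; rewrite -scalerBr -[_ - _]mul1r scalerAl.
by apply: ideal_mull; exact: qreprB.
Qed.

Lemma q_mulA : associative q_mul.
Proof.
move=> x y z; rewrite -(qreprK x) -(qreprK y) -(qreprK z).
by rewrite !qpi_mul mulrA.
Qed.
Lemma q_mul1l : left_id (qpi 1) q_mul.
Proof. by move=> x; rewrite -(qreprK x) qpi_mul mul1r. Qed.
Lemma q_mul1r : right_id (qpi 1) q_mul.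
Proof. by move=> x; rewrite -(qreprK x) qpi_mul mulr1. Qed.
Lemma q_mulDl : left_distributive q_mul +%R.
Proof.
move=> x y z; rewrite -(qreprK x) -(qreprK y) -(qreprK z).
by rewrite -raddfD !qpi_mul mulrDl raddfD.
Qed.
Lemma q_mulDr : right_distributive q_mul +%R.
Proof.
move=> x y z; rewrite -(qreprK x) -(qreprK y) -(qreprK z).
by rewrite -raddfD !qpi_mul mulrDr raddfD.
Qed.
Lemma q_one_neq0 : qpi 1 != 0.
Proof.
apply/eqP => e; move: (ideal_proper I).
have /qpi_eq : qpi 1 = qpi 0 by rewrite e raddf0.
by rewrite subr0 => ->.
Qed.

HB.instance Definition _ := GRing.Zmodule_isNzRing.Build quot_alg
  q_mulA q_mul1l q_mul1r q_mulDl q_mulDr q_one_neq0.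

Lemma q_scaleA a b x : q_scale a (q_scale b x) = q_scale (a * b) x.
Proof. by rewrite -(qreprK x) !qpi_scale scalerA. Qed.
Lemma q_scale1 : left_id 1 q_scale.
Proof. by move=> x; rewrite -(qreprK x) qpi_scale scale1r. Qed.
Lemma q_scaleDr : right_distributive q_scale +%R.
Proof.
move=> a x y; rewrite -(qreprK x) -(qreprK y) -raddfD !qpi_scale.
by rewrite scalerDr raddfD.
Qed.
Lemma q_scaleDl x : {morph q_scale^~ x : a b / a + b}.
Proof. by move=> a b; rewrite -(qreprK x) !qpi_scale scalerDl raddfD. Qed.

HB.instance Definition _ := GRing.Zmodule_isLmodule.Build k quot_alg
  q_scaleA q_scale1 q_scaleDr q_scaleDl.

Lemma qpiM x y : qpi (x * y) = qpi x * qpi y.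
Proof. by rewrite -[RHS]/(q_mul _ _) qpi_mul. Qed.
Lemma qpiZ c x : qpi (c *: x) = c *: qpi x.
Proof. by rewrite -[RHS]/(q_scale _ _) qpi_scale. Qed.

HB.instance Definition _ := GRing.isMonoidMorphism.Build A quot_alg qpi
  (conj (erefl (qpi 1)) qpiM).
HB.instance Definition _ := GRing.isScalable.Build k A quot_alg *:%R qpi qpiZ.

Lemma q_scalerAl c (x y : quot_alg) : c *: (x * y) = (c *: x) * y.
Proof.
by rewrite -(qreprK x) -(qreprK y) -qpiM -!qpiZ -qpiM scalerAl.
Qed.
HB.instance Definition _ :=
  GRing.Lmodule_isLalgebra.Build k quot_alg q_scalerAl.
Lemma q_scalerAr c (x y : quot_alg) : c *: (x * y) = x * (c *: y).
Proof.
by rewrite -(qreprK x) -(qreprK y) -qpiM -!qpiZ -qpiM scalerAr.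
Qed.
HB.instance Definition _ := GRing.Lalgebra_isAlgebra.Build k quot_alg q_scalerAr.

Section Induced.
Variables (F : {lrmorphism A -> A}).
Hypothesis FI : {homo F : x / x \in ideal_mem I}.

Definition quot_map (x : quot_alg) : quot_alg := qpi (F (qrepr x)).

Lemma quot_mapE x : quot_map (qpi x) = qpi (F x).
Proof. by apply/esym/qpi_eq; rewrite -raddfB; apply: FI; exact: qreprB. Qed.

Lemma quot_map_is_linear : linear quot_map.
Proof.
move=> c x y; rewrite -(qreprK x) -(qreprK y) -qpiZ -raddfD !quot_mapE.
by rewrite -qpiZ -raddfD linearP.
Qed.

Lemma quot_map_is_monoid_morphism : monoid_morphism quot_map.
Proof.
split=> [|x y].
  by rewrite -[1]/(qpi 1) quot_mapE; congr qpi; exact: rmorph1.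
rewrite -(qreprK x) -(qreprK y) -(qpiM (qrepr x)) !quot_mapE rmorphM.
exact: qpiM.
Qed.
End Induced.

End QuotientAlgebra.

Section Preprojective.
Variables (k : fieldType) (Q : quiver).

(* [inl a] is the nonstar arrow a and [inr a] is the star arrow a^*. *)
Definition double_quiver : quiver := {|
  vertex := vertex Q;
  arrow := (arrow Q + arrow Q)%type;
  source b := match b with inl a => source a | inr a => target a end;
  target b := match b with inl a => target a | inr a => source a end;
  vertex_pt := vertex_pt Q
|}.

Local Notation kQ2 := (path_algebra k double_quiver).

Definition pa_arrow (b : arrow double_quiver) : kQ2 := path_elt (arrow_path b).

Definition Omega : kQ2 :=
  \sum_(a : arrow Q) (pa_arrow (inl a) * pa_arrow (inr a) -
                      pa_arrow (inr a) * pa_arrow (inl a)).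

Definition in_Omega_ideal (x : kQ2) : Prop :=
  exists s : seq (kQ2 * kQ2), x = \sum_(u <- s) u.1 * Omega * u.2.

Definition Omega_ideal_pred : {pred kQ2} := fun x => `[< in_Omega_ideal x >].

Lemma Omega_idealP x : reflect (in_Omega_ideal x) (x \in Omega_ideal_pred).
Proof. exact: asboolP. Qed.

Lemma Omega_ideal_zmod : zmod_closed Omega_ideal_pred.
Proof.
split=> [|x y /Omega_idealP[s ->] /Omega_idealP[t ->]]; apply/Omega_idealP.
  by exists [::]; rewrite big_nil.
exists (s ++ [seq (- u.1, u.2) | u <- t]); rewrite big_cat /= big_map.
by congr (_ + _); rewrite -sumrN; apply: eq_bigr => u _; rewrite !mulNr.
Qed.

Lemma Omega_ideal_mull a x :
  x \in Omega_ideal_pred -> a * x \in Omega_ideal_pred.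
Proof.
move=> /Omega_idealP[s ->]; apply/Omega_idealP.
exists [seq (a * u.1, u.2) | u <- s]; rewrite big_map mulr_sumr.
by apply: eq_bigr => u _; rewrite !mulrA.
Qed.

Lemma Omega_ideal_mulr a x :
  x \in Omega_ideal_pred -> x * a \in Omega_ideal_pred.
Proof.
move=> /Omega_idealP[s ->]; apply/Omega_idealP.
exists [seq (u.1, u.2 * a) | u <- s]; rewrite big_map mulr_suml.
by apply: eq_bigr => u _; rewrite !mulrA.
Qed.

Lemma Omega_ideal_triv v x : x \in Omega_ideal_pred -> x@_(triv_path v) = 0.
Proof.
have arr0 b : (pa_arrow b)@_(triv_path v) = 0.
  by rewrite /pa_arrow path_elt.unlock mcoeffU; case: eqP => // -[].
move=> /Omega_idealP[s ->]; rewrite raddf_sum big1 // => u _ /=.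
rewrite (mcoeff_triv_mul v (u.1 * Omega)) (mcoeff_triv_mul v u.1).
suff -> : Omega@_(triv_path v) = 0 by rewrite mulr0 mul0r.
rewrite /Omega raddf_sum big1 // => a _ /=.
rewrite mcoeffB (mcoeff_triv_mul v (pa_arrow (inl a))).
by rewrite (mcoeff_triv_mul v (pa_arrow (inr a))) !arr0 mulr0 subr0.
Qed.

Lemma Omega_ideal_proper : 1 \notin Omega_ideal_pred.
Proof.
apply/negP => /(Omega_ideal_triv (vertex_pt double_quiver)).
rewrite -[1]/(pa_one k double_quiver) pa_one_triv => /eqP.
by rewrite oner_eq0.
Qed.

Definition Omega_ideal : ideal2 kQ2 :=
  Ideal2 Omega_ideal_zmod Omega_ideal_mull Omega_ideal_mulr Omega_ideal_proper.

Definition preproj := quot_alg Omega_ideal.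

HB.instance Definition _ := GRing.Algebra.on preproj.

Definition pp_path (p : qpath double_quiver) : preproj :=
  qpi Omega_ideal (path_elt p).
Definition pp_vertex (v : vertex Q) : preproj :=
  pp_path (@triv_path double_quiver v).
Definition pp_arrow (a : arrow Q) : preproj :=
  pp_path (@arrow_path double_quiver (inl a)).
Definition pp_star (a : arrow Q) : preproj :=
  pp_path (@arrow_path double_quiver (inr a)).

Lemma pp_relation :
  \sum_(a : arrow Q) (pp_arrow a * pp_star a - pp_star a * pp_arrow a) = 0.
Proof.
transitivity (qpi Omega_ideal Omega); last first.
  apply: qpi_eq0; apply/Omega_idealP; exists [:: (1, 1)].
  by rewrite big_seq1 mul1r mulr1.
rewrite /Omega raddf_sum; apply: eq_bigr => a _.
by rewrite raddfB /= !qpiM.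
Qed.

Lemma pp_vertex_inj : injective pp_vertex.
Proof.
move=> v w /qpi_eq /(Omega_ideal_triv v).
have eltE u : (path_elt (@triv_path double_quiver u) : kQ2)@_(
    @triv_path double_quiver v) = (u == v)%:R.
  rewrite path_elt.unlock mcoeffU; congr ((nat_of_bool _)%:R).
  apply/eqP/eqP => [/(congr1 path_source) //|-> //].
rewrite mcoeffB !eltE eqxx; case: eqP => // _ /eqP.
by rewrite subr0 oner_eq0.
Qed.

Lemma pp_ext (F G : {lrmorphism preproj -> preproj}) :
  (forall v, F (pp_vertex v) = G (pp_vertex v)) ->
  (forall a, F (pp_arrow a) = G (pp_arrow a)) ->
  (forall a, F (pp_star a) = G (pp_star a)) -> F =1 G.
Proof.
move=> FGv FGa FGs x; rewrite -(qreprK x).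
elim/pa_ind: (qrepr x) => [c f g IH IH'||p].
- have HP (H : {lrmorphism preproj -> preproj}) :
    H (qpi _ (c *: f + g)) = c *: H (qpi _ f) + H (qpi _ g).
    by rewrite (raddfD (qpi _)) /= qpiZ linearP.
  by rewrite !HP IH IH'.
- by rewrite !raddf0.
case: p => -[v s] /= w; elim: s v w => [|b s IH] v w.
  rewrite (_ : @QPath double_quiver (v, [::]) w = @triv_path double_quiver v);
    first exact: FGv.
  exact: qpath_eq.
case/andP: (w) => /eqP ev ws.
have -> : path_elt (@QPath double_quiver (v, b :: s) w) =
    path_elt (@arrow_path double_quiver b) * path_elt (@QPath _ (target b, s) ws)
    :> path_algebra k _.
  rewrite path_eltM /path_mul.
  case: path_concatP => [r e1 e2 e3 _|/eqP//].
  by congr path_elt; apply: qpath_eq; rewrite ?e2 ?e3.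
rewrite qpiM !rmorphM /= (IH _ ws); congr (_ * _).
by case: b {ev ws w} => a; [exact: FGa | exact: FGs].
Qed.

End Preprojective.

Arguments pp_path {k Q}.
Arguments pp_vertex {k Q}.
Arguments pp_arrow {k Q}.
Arguments pp_star {k Q}.

Record quiver_aut (Q : quiver) := QuiverAut {
  qa_vertex : vertex Q -> vertex Q;
  qa_arrow : arrow Q -> arrow Q;
  qa_vertex_inj : injective qa_vertex;
  qa_arrow_inj : injective qa_arrow;
  qa_source : forall a, source (qa_arrow a) = qa_vertex (source a);
  qa_target : forall a, target (qa_arrow a) = qa_vertex (target a)
}.

Section PathMap.
Variables (k : fieldType) (Q : quiver) (phi : quiver_aut Q).

Lemma walk_map v s :
  walk (qa_vertex phi v) (map (qa_arrow phi) s) = walk v s.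
Proof.
elim: s v => //= a s IH v.
by rewrite qa_source qa_target IH (inj_eq (@qa_vertex_inj _ phi)).
Qed.

Lemma walk_end_map v s :
  walk_end (qa_vertex phi v) (map (qa_arrow phi) s) =
  qa_vertex phi (walk_end v s).
Proof. by elim: s v => //= a s IH v; rewrite qa_target IH. Qed.

Lemma path_map_walk (p : qpath Q) :
  walk (qa_vertex phi (path_source p)) (map (qa_arrow phi) (path_arrows p)).
Proof. by rewrite walk_map; exact: path_walk. Qed.

Definition path_map (p : qpath Q) : qpath Q :=
  @QPath Q (qa_vertex phi (path_source p), map (qa_arrow phi) (path_arrows p))
    (path_map_walk p).

Lemma path_map_target p : path_target (path_map p) = qa_vertex phi (path_target p).
Proof. exact: walk_end_map. Qed.

Lemma path_map_concat p q :
  path_concat (path_map p) (path_map q) = omap path_map (path_concat p q).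
Proof.
case: (path_concatP p q) => [r e1 e2 e3 e4|ne];
  case: path_concatP => [r' f1 f2 f3 f4|] //=.
- congr Some; apply: qpath_eq; first by rewrite f2 /path_source /= e2.
  by rewrite f3 /path_arrows /= e3 map_cat.
- by rewrite path_map_target e1 eqxx.
- by move: f1; rewrite path_map_target => /qa_vertex_inj e; rewrite e eqxx in ne.
Qed.

Local Notation kQ := (path_algebra k Q).

Definition pa_map (f : kQ) : kQ := lext (fun p => path_elt (path_map p)) f.

Lemma pa_map_linear : linear pa_map.
Proof. by move=> c f g; rewrite /pa_map linearP. Qed.

HB.instance Definition _ := GRing.isLinear.Build k kQ kQ *:%R pa_map pa_map_linear.

Lemma pa_map_elt p : pa_map (path_elt p) = path_elt (path_map p).
Proof. by rewrite /pa_map path_elt.unlock lextU. Qed.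

Lemma pa_map_monoid_morphism : monoid_morphism pa_map.
Proof.
split=> [|f g].
  rewrite -[1]/(pa_one k Q) /pa_one linear_sum /=.
  rewrite [RHS](reindex_inj (@qa_vertex_inj _ phi)); apply: eq_bigr => v _ /=.
  by rewrite pa_map_elt; congr path_elt; apply: qpath_eq.
have mapP c (x y : kQ) : pa_map (c *: x + y) = c *: pa_map x + pa_map y.
  exact: linearP.
have map0 : pa_map 0 = 0 by exact: linear0.
elim/pa_ind: f => [c f f' IH IH'||p].
- by rewrite mulrDl -scalerAl !mapP IH IH' mulrDl scalerAl.
- by rewrite mul0r map0 mul0r.
elim/pa_ind: g => [c f f' IH IH'||q].
- by rewrite mulrDr -scalerAr !mapP IH IH' mulrDr scalerAr.
- by rewrite mulr0 map0 mulr0.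
rewrite !pa_map_elt !path_eltM /path_mul path_map_concat.
by case: (path_concat p q) => [r|] /=; rewrite ?pa_map_elt ?map0.
Qed.

HB.instance Definition _ :=
  GRing.isMonoidMorphism.Build kQ kQ pa_map pa_map_monoid_morphism.

End PathMap.

(* A left action; each [aact g] is an automorphism, with inverse [aact g^-1]. *)
Record alg_action (k : fieldType) (gT : finGroupType) (A : algType k) :=
  AlgAction {
    aact :> gT -> {lrmorphism A -> A};
    aact1 : forall x, aact 1%g x = x;
    aactM : forall g h x, aact (g * h)%g x = aact g (aact h x)
  }.

Lemma subg_mulE (gT : finGroupType) (G : {group gT}) (g h : subg_of G) :
  sgval (g * h)%g = (sgval g * sgval h)%g.
Proof. by []. Qed.

(* The formal sum of the a_g # g is the family of its coefficients a_g; the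
   unused argument [to] determines the product, declared below. *)
Definition skew (k : fieldType) (gT : finGroupType) (A : algType k)
  (to : alg_action gT A) (G : {group gT}) := {ffun subg_of G -> A}.

HB.instance Definition _ (k : fieldType) (gT : finGroupType) (A : algType k)
  (to : alg_action gT A) (G : {group gT}) := GRing.Lmodule.on (skew to G).

Section SkewGroupAlgebra.
Variables (k : fieldType) (gT : finGroupType) (A : algType k).
Variables (to : alg_action gT A) (G : {group gT}).

Local Notation skew := (skew to G).

Implicit Types (x y z : skew) (g h u : subg_of G).

Definition skew_elt (a : A) g : skew := [ffun h => if h == g then a else 0].

(* The coefficient of u in (sum_g a_g # g) (sum_h b_h # h) collects the pairs
   with g h = u; see [skew_eltM] for the rule (a # g) (b # h) = a g(b) # g h. *)
Definition skew_mul x y : skew :=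
  [ffun u => \sum_(g : subg_of G) x g * to (sgval g) (y (g^-1 * u)%g)].

Definition skew_one : skew := skew_elt 1 1%g.

Lemma skew_mulA : associative skew_mul.
Proof.
move=> x y z; apply/ffunP => u; rewrite !ffunE.
transitivity (\sum_g \sum_h
    x g * (to (sgval g) (y h) * to (sgval (g * h)%g) (z ((g * h)^-1 * u)%g))).
  apply: eq_bigr => g _; rewrite ffunE raddf_sum mulr_sumr; apply: eq_bigr => h _.
  by rewrite /= rmorphM /= -aactM invMg !mulgA.
rewrite exchange_big /=; under [RHS]eq_bigr do rewrite ffunE mulr_suml.
rewrite [RHS]exchange_big /= exchange_big; apply: eq_bigr => g _ /=.
rewrite [RHS](reindex_inj (mulgI g)); apply: eq_bigr => h _ /=.
by rewrite mulKg mulrA.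
Qed.

Lemma skew_mul1l : left_id skew_one skew_mul.
Proof.
move=> x; apply/ffunP => u; rewrite ffunE (bigD1 1%g) //= ffunE eqxx.
rewrite big1 ?addr0; first by rewrite mul1r aact1 invg1 mul1g.
by move=> g /negPf ng; rewrite ffunE ng mul0r.
Qed.

Lemma skew_mul1r : right_id skew_one skew_mul.
Proof.
move=> x; apply/ffunP => u; rewrite ffunE (bigD1 u) //= ffunE mulVg eqxx.
rewrite big1 ?addr0; first by rewrite rmorph1 mulr1.
move=> g /negPf ng; rewrite ffunE -eq_mulVg1 ng.
by rewrite raddf0 mulr0.
Qed.

Lemma skew_mulDl : left_distributive skew_mul +%R.
Proof.
move=> x y z; apply/ffunP => u; rewrite !ffunE -big_split.
by apply: eq_bigr => g _; rewrite /= !ffunE mulrDl.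
Qed.

Lemma skew_mulDr : right_distributive skew_mul +%R.
Proof.
move=> x y z; apply/ffunP => u; rewrite !ffunE -big_split.
by apply: eq_bigr => g _; rewrite /= !ffunE raddfD mulrDr.
Qed.

Lemma skew_one_neq0 : skew_one != 0.
Proof.
by apply/eqP => /ffunP/(_ 1%g)/eqP; rewrite !ffunE eqxx oner_eq0.
Qed.

HB.instance Definition _ := GRing.Zmodule_isNzRing.Build skew
  skew_mulA skew_mul1l skew_mul1r skew_mulDl skew_mulDr skew_one_neq0.

Lemma skew_mulE x y u :
  (x * y) u = \sum_(g : subg_of G) x g * to (sgval g) (y (g^-1 * u)%g).
Proof. by rewrite ffunE. Qed.

Lemma skew_scalerAl c x y : c *: (x * y) = (c *: x) * y.
Proof.
apply/ffunP => u; rewrite ffunE !skew_mulE scaler_sumr.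
by apply: eq_bigr => g _; rewrite ffunE scalerAl.
Qed.

HB.instance Definition _ := GRing.Lmodule_isLalgebra.Build k skew skew_scalerAl.

Lemma skew_scalerAr c x y : c *: (x * y) = x * (c *: y).
Proof.
apply/ffunP => u; rewrite ffunE !skew_mulE scaler_sumr.
by apply: eq_bigr => g _; rewrite ffunE linearZ /= scalerAr.
Qed.

HB.instance Definition _ := GRing.Lalgebra_isAlgebra.Build k skew skew_scalerAr.

Lemma skew_eltM a b g h :
  skew_elt a g * skew_elt b h = skew_elt (a * to (sgval g) b) (g * h)%g.
Proof.
apply/ffunP => u; rewrite skew_mulE (bigD1 g) //= !ffunE eqxx big1 => [|i ni].
  rewrite addr0 -(inj_eq (mulgI g)) mulKVg.
  by case: eqP; rewrite ?raddf0 ?mulr0.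
by rewrite ffunE (negPf ni) mul0r.
Qed.

Lemma skew_sum x : x = \sum_(g : subg_of G) skew_elt (x g) g.
Proof.
apply/ffunP => u; rewrite sum_ffunE (bigD1 u) //= ffunE eqxx big1 ?addr0 //.
by move=> g ng; rewrite ffunE eq_sym (negPf ng).
Qed.

End SkewGroupAlgebra.

Section FixedRing.
Variables (k : fieldType) (gT : finGroupType) (A : algType k).
Variables (to : alg_action gT A) (G : {group gT}).

Definition fixed_ring : {pred A} :=
  fun x => [forall g in G, to g x == x].

Lemma fixed_ringP x :
  reflect {in G, forall g, to g x = x} (x \in fixed_ring).
Proof. exact: 'forall_in_eqP. Qed.

Lemma fixed_ring_subalg : subalg_closed fixed_ring.
Proof.
split=> [|c x y /fixed_ringP fx /fixed_ringP fy|x y /fixed_ringP fx /fixed_ringP fy];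
  apply/fixed_ringP => g gG.
- exact: rmorph1.
- by rewrite linearP /= fx ?fy.
- by rewrite rmorphM /= fx ?fy.
Qed.

HB.instance Definition _ :=
  GRing.isSubalgClosed.Build k A fixed_ring fixed_ring_subalg.

End FixedRing.

Section RightEndomorphisms.
Variables (k : fieldType) (A : algType k) (S : subalgClosed A).

Definition right_linear (f : A -> A) : Prop :=
  (forall x y, f (x + y) = f x + f y) /\
  (forall x s, s \in S -> f (x * s) = f x * s).

Definition right_linear_pred : {pred A -> A} := fun f => `[< right_linear f >].

Lemma right_linearP f : reflect (right_linear f) (f \in right_linear_pred).
Proof. exact: asboolP. Qed.

Lemma right_linear_submod : submod_closed right_linear_pred.
Proof.
split=> [|c f g /right_linearP[fD fS] /right_linearP[gD gS]];
  apply/right_linearP; split.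
- by move=> x y; rewrite /= addr0.
- by move=> x s _; rewrite /= mul0r.
- by move=> x y; rewrite !fctE fD gD scalerDr addrACA.
- by move=> x s sS; rewrite !fctE fS // gS // scalerAl mulrDl.
Qed.

HB.instance Definition _ :=
  GRing.isSubmodClosed.Build k (A -> A) right_linear_pred right_linear_submod.

(* End_S(A) for A as a right S-module, with composition as product. *)
Record right_end := RightEnd {
  right_end_fun :> A -> A;
  right_end_mem : right_end_fun \in right_linear_pred
}.

HB.instance Definition _ := [isSub for right_end_fun].
HB.instance Definition _ := [Choice of right_end by <:].
HB.instance Definition _ := [SubChoice_isSubLmodule of right_end by <:].

Implicit Types f g h : right_end.

Lemma right_endP f : right_linear f.
Proof. exact/right_linearP/right_end_mem. Qed.

Lemma right_end_ext f g : f =1 g -> f = g.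
Proof. by move=> fg; apply: val_inj; apply: funext. Qed.

Lemma right_endDE f g x : (f + g) x = f x + g x. Proof. by []. Qed.
Lemma right_endZE c f x : (c *: f) x = c *: f x. Proof. by []. Qed.
Lemma right_end0E x : (0 : right_end) x = 0. Proof. by []. Qed.

Lemma right_end_id_mem : idfun \in right_linear_pred.
Proof. exact/right_linearP. Qed.

Lemma right_end_comp_mem f g : f \o g \in right_linear_pred.
Proof.
apply/right_linearP; have [fD fS] := right_endP f; have [gD gS] := right_endP g.
by split=> [x y|x s sS] /=; rewrite ?gD ?fD // gS ?fS.
Qed.

Definition right_end_id : right_end := RightEnd right_end_id_mem.
Definition right_end_comp f g : right_end := RightEnd (right_end_comp_mem f g).

Lemma right_end_compA : associative right_end_comp.
Proof. by move=> f g h; apply: right_end_ext. Qed.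
Lemma right_end_comp1l : left_id right_end_id right_end_comp.
Proof. by move=> f; apply: right_end_ext. Qed.
Lemma right_end_comp1r : right_id right_end_id right_end_comp.
Proof. by move=> f; apply: right_end_ext. Qed.
Lemma right_end_compDl : left_distributive right_end_comp +%R.
Proof. by move=> f g h; apply: right_end_ext. Qed.
Lemma right_end_compDr : right_distributive right_end_comp +%R.
Proof.
by move=> f g h; apply: right_end_ext => x; exact: (right_endP f).1.
Qed.
Lemma right_end_id_neq0 : right_end_id != 0.
Proof.
apply/eqP => /(congr1 (fun f : right_end => f 1)) /eqP.
by rewrite right_end0E oner_eq0.
Qed.

HB.instance Definition _ := GRing.Zmodule_isNzRing.Build right_end
  right_end_compA right_end_comp1l right_end_comp1r right_end_compDl
  right_end_compDr right_end_id_neq0.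

Lemma right_endME f g x : (f * g) x = f (g x). Proof. by []. Qed.
Lemma right_end1E x : (1 : right_end) x = x. Proof. by []. Qed.

Lemma right_end_scalerAl c f g : c *: (f * g) = (c *: f) * g.
Proof. by apply: right_end_ext. Qed.

HB.instance Definition _ :=
  GRing.Lmodule_isLalgebra.Build k right_end right_end_scalerAl.

Lemma right_end_scalerAr c f g : c *: (f * g) = f * (c *: g).
Proof.
apply: right_end_ext => x; rewrite right_endZE !right_endME right_endZE.
have cS : c%:A \in S by rewrite rpredZ ?rpred1.
by rewrite -[c *: g x]mulr_algr (right_endP f).2 // mulr_algr.
Qed.

HB.instance Definition _ :=
  GRing.Lalgebra_isAlgebra.Build k right_end right_end_scalerAr.

End RightEndomorphisms.

Section Auslander.
Variables (k : fieldType) (gT : finGroupType) (A : algType k).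
Variables (to : alg_action gT A) (G : {group gT}).

Definition auslander_fun (x : skew to G) (b : A) : A :=
  \sum_(g : subg_of G) x g * to (sgval g) b.

Lemma auslander_mem x :
  auslander_fun x \in right_linear_pred (fixed_ring to G).
Proof.
apply/right_linearP; split=> [b c|b s /fixed_ringP sG]; rewrite /auslander_fun.
  by rewrite -big_split; apply: eq_bigr => g _; rewrite /= raddfD mulrDr.
rewrite mulr_suml; apply: eq_bigr => g _.
by rewrite rmorphM /= sG ?subgP // mulrA.
Qed.

Definition auslander (x : skew to G) : right_end (fixed_ring to G) :=
  RightEnd (auslander_mem x).

Lemma auslander_elt a g b : auslander (skew_elt to a g) b = a * to (sgval g) b.
Proof.
rewrite /= /auslander_fun (bigD1 g) //= ffunE eqxx big1 ?addr0 // => h nh.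
by rewrite ffunE (negPf nh) mul0r.
Qed.

Lemma auslander_linear : linear auslander.
Proof.
move=> c x y; apply: right_end_ext => b.
rewrite right_endDE right_endZE /= /auslander_fun scaler_sumr -big_split.
by apply: eq_bigr => g _; rewrite /= !ffunE mulrDl scalerAl.
Qed.

Lemma auslander_monoid_morphism : monoid_morphism auslander.
Proof.
split=> [|x y]; apply: right_end_ext => b.
  by rewrite -[1]/(skew_one to G) auslander_elt mul1r aact1.
rewrite right_endME /= /auslander_fun.
under eq_bigr do rewrite skew_mulE mulr_suml.
rewrite exchange_big; apply: eq_bigr => g _ /=; rewrite raddf_sum mulr_sumr.
rewrite (reindex_inj (mulgI g)); apply: eq_bigr => h _ /=.
by rewrite mulKg ?subg_mulE aactM rmorphM mulrA.
Qed.

HB.instance Definition _ := GRing.isLinear.Build k (skew to G)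
  (right_end (fixed_ring to G)) *:%R auslander auslander_linear.
HB.instance Definition _ := GRing.isMonoidMorphism.Build (skew to G)
  (right_end (fixed_ring to G)) auslander auslander_monoid_morphism.

End Auslander.

Arguments auslander_fun {k gT A} to G x b.
Arguments auslander {k gT A} to G x.

(* ['Z_n] is Z/n only for n > 1; the quiver is meant for n > 2. *)
Definition cyclic_quiver (n : nat) : quiver := {|
  vertex := 'Z_n;
  arrow := 'Z_n;
  source i := i;
  target i := i + 1;
  vertex_pt := 0
|}.

Section Rotation.
Variable n : nat.
Local Notation Q2 := (double_quiver (cyclic_quiver n)).

Definition rho_vertex (i : vertex Q2) : vertex Q2 := i + 1 :> 'Z_n.
Definition rho_arrow (b : arrow Q2) : arrow Q2 :=
  match b with
  | inl i => inl (i + 1 : 'Z_n)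
  | inr i => inr (i + 1 : 'Z_n)
  end.

Definition refl_vertex (i : vertex Q2) : vertex Q2 := - i :> 'Z_n.
Definition refl_arrow (b : arrow Q2) : arrow Q2 :=
  match b with
  | inl i => inr (- i - 1 : 'Z_n)
  | inr i => inl (- i - 1 : 'Z_n)
  end.

Lemma rho_vertex_inj : injective rho_vertex.
Proof. exact: addIr. Qed.
Lemma rho_arrow_inj : injective rho_arrow.
Proof.
move=> [i|i] [j|j] //= e; congr (_ _).
  exact: (@addIr 'Z_n _ _ _ (inl_inj e)).
exact: (@addIr 'Z_n _ _ _ (inr_inj e)).
Qed.
Lemma rho_source b : source (rho_arrow b) = rho_vertex (source b).
Proof. by case: b. Qed.
Lemma rho_target b : target (rho_arrow b) = rho_vertex (target b).
Proof. by case: b. Qed.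

Lemma refl_vertex_inj : injective refl_vertex.
Proof. exact: oppr_inj. Qed.
Lemma refl_arrow_inj : injective refl_arrow.
Proof.
move=> [i|i] [j|j] //= e; congr (_ _).
  exact: oppr_inj (@addIr 'Z_n _ _ _ (inr_inj e)).
exact: oppr_inj (@addIr 'Z_n _ _ _ (inl_inj e)).
Qed.
Lemma refl_source b : source (refl_arrow b) = refl_vertex (source b).
Proof. by case: b => i /=; rewrite /refl_vertex ?subrK ?opprD. Qed.
Lemma refl_target b : target (refl_arrow b) = refl_vertex (target b).
Proof. by case: b => i /=; rewrite /refl_vertex ?subrK ?opprD. Qed.

Definition rho_quiver : quiver_aut Q2 :=
  QuiverAut rho_vertex_inj rho_arrow_inj rho_source rho_target.
Definition refl_quiver : quiver_aut Q2 :=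
  QuiverAut refl_vertex_inj refl_arrow_inj refl_source refl_target.

End Rotation.

Section DihedralAction.
Variables (k : fieldType) (n : nat).
Local Notation Q := (cyclic_quiver n).
Local Notation kQ2 := (path_algebra k (double_quiver Q)).
Local Notation R := (preproj k Q).
Local Notation Om := (Omega k Q).

Lemma Omega_ideal_homo (F : {lrmorphism kQ2 -> kQ2}) :
  F Om \in Omega_ideal k Q -> {homo F : x / x \in Omega_ideal k Q}.
Proof.
move=> FO x /Omega_idealP[s ->]; rewrite raddf_sum.
apply: rpred_sum => u _ /=; rewrite (rmorphM F (u.1 * Om)) (rmorphM F u.1).
exact: (@Omega_ideal_mulr k Q _ _ (@Omega_ideal_mull k Q _ _ FO)).
Qed.

Lemma Omega_mem : Om \in Omega_ideal k Q.
Proof.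
by apply/Omega_idealP; exists [:: (1, 1)]; rewrite big_seq1 mul1r mulr1.
Qed.

Lemma pa_map_arrow (phi : quiver_aut (double_quiver Q)) b :
  pa_map phi (pa_arrow k b) = pa_arrow k (qa_arrow phi b).
Proof.
rewrite /pa_arrow pa_map_elt; congr path_elt; apply: qpath_eq => //.
exact/esym/qa_source.
Qed.

Lemma pa_map_Omega (phi : quiver_aut (double_quiver Q)) :
  pa_map phi Om = \sum_(i : 'Z_n)
    (pa_arrow k (qa_arrow phi (inl i)) * pa_arrow k (qa_arrow phi (inr i)) -
     pa_arrow k (qa_arrow phi (inr i)) * pa_arrow k (qa_arrow phi (inl i))).
Proof.
rewrite raddf_sum; apply: eq_bigr => i _ /=.
rewrite (raddfB (pa_map phi)) /= (rmorphM (pa_map phi) (pa_arrow k _)).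
by rewrite (rmorphM (pa_map phi) (pa_arrow k (inr i))) /= !pa_map_arrow.
Qed.

Lemma rho_Omega : pa_map (rho_quiver n) Om = Om.
Proof.
rewrite pa_map_Omega [RHS](reindex_inj (@rho_vertex_inj n)).
by apply: eq_bigr => i _.
Qed.

Lemma refl_Omega : pa_map (refl_quiver n) Om = - Om.
Proof.
have inj : injective (fun i : 'Z_n => - i - 1).
  by move=> i j /(@addIr 'Z_n _)/oppr_inj.
rewrite pa_map_Omega -sumrN [RHS](reindex_inj inj).
by apply: eq_bigr => i _; rewrite opprB.
Qed.

Lemma rho_ideal :
  {homo pa_map (rho_quiver n) : x / x \in Omega_ideal k Q}.
Proof. by apply: Omega_ideal_homo; rewrite /= rho_Omega Omega_mem. Qed.

Lemma refl_ideal :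
  {homo pa_map (refl_quiver n) : x / x \in Omega_ideal k Q}.
Proof. by apply: Omega_ideal_homo; rewrite /= refl_Omega; exact: rpredNr Omega_mem. Qed.

Definition rho (x : R) : R :=
  @quot_map k _ (Omega_ideal k Q) (pa_map (rho_quiver n)) x.
Definition refl (x : R) : R :=
  @quot_map k _ (Omega_ideal k Q) (pa_map (refl_quiver n)) x.

HB.instance Definition _ :=
  GRing.isLinear.Build k R R *:%R rho (quot_map_is_linear rho_ideal).
HB.instance Definition _ :=
  GRing.isMonoidMorphism.Build R R rho (quot_map_is_monoid_morphism rho_ideal).
HB.instance Definition _ :=
  GRing.isLinear.Build k R R *:%R refl (quot_map_is_linear refl_ideal).
HB.instance Definition _ :=
  GRing.isMonoidMorphism.Build R R refl (quot_map_is_monoid_morphism refl_ideal).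

Local Notation e := (@pp_vertex k Q).
Local Notation al := (@pp_arrow k Q).
Local Notation als := (@pp_star k Q).

Lemma rho_path p : rho (pp_path p) = pp_path (path_map (rho_quiver n) p).
Proof. by rewrite /rho /pp_path (quot_mapE rho_ideal) /= pa_map_elt. Qed.
Lemma refl_path p : refl (pp_path p) = pp_path (path_map (refl_quiver n) p).
Proof. by rewrite /refl /pp_path (quot_mapE refl_ideal) /= pa_map_elt. Qed.

Lemma rho_e (i : 'Z_n) : rho (e i) = e (i + 1).
Proof. by rewrite /pp_vertex rho_path; congr pp_path; apply: qpath_eq. Qed.
Lemma rho_al (i : 'Z_n) : rho (al i) = al (i + 1).
Proof. by rewrite /pp_arrow rho_path; congr pp_path; apply: qpath_eq. Qed.
Lemma rho_als (i : 'Z_n) : rho (als i) = als (i + 1).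
Proof. by rewrite /pp_star rho_path; congr pp_path; apply: qpath_eq. Qed.

Lemma refl_e (i : 'Z_n) : refl (e i) = e (- i).
Proof. by rewrite /pp_vertex refl_path; congr pp_path; apply: qpath_eq. Qed.
Lemma refl_al (i : 'Z_n) : refl (al i) = als (- i - 1).
Proof.
rewrite /pp_arrow refl_path; congr pp_path; apply: qpath_eq => //.
exact/esym/(refl_source (inl i)).
Qed.
Lemma refl_als (i : 'Z_n) : refl (als i) = al (- i - 1).
Proof.
rewrite /pp_star refl_path; congr pp_path; apply: qpath_eq => //.
exact/esym/(refl_source (inr i)).
Qed.

Fixpoint lr_iter (m : nat) (F : {lrmorphism R -> R}) : {lrmorphism R -> R} :=
  if m is m'.+1 then F \o lr_iter m' F else idfun.

Lemma lr_iterE m F x : lr_iter m F x = iter m F x.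
Proof. by elim: m => //= m ->. Qed.

End DihedralAction.

(* The pair (j, b) stands for rho^j r^b, and r rho = rho^-1 r. *)
Definition dihedral (n : nat) : Type := ('Z_n * bool)%type.

HB.instance Definition _ (n : nat) := Finite.on (dihedral n).

Section DihedralGroup.
Variable n : nat.
Implicit Types g h : dihedral n.

Definition dihedral_mul g h : dihedral n :=
  (g.1 + (if g.2 then - h.1 else h.1), g.2 (+) h.2).
Definition dihedral_one : dihedral n := (0, false).
Definition dihedral_inv g : dihedral n := (if g.2 then g.1 else - g.1, g.2).

Lemma dihedral_mulA : associative dihedral_mul.
Proof.
move=> [i b] [j c] [l d]; rewrite /dihedral_mul /= addbA; congr pair.
by case: b; case: c; rewrite /= ?opprD ?opprK !addrA.
Qed.
Lemma dihedral_mul1g : left_id dihedral_one dihedral_mul.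
Proof. by move=> [j c]; rewrite /dihedral_mul /= add0r. Qed.
Lemma dihedral_mulVg : left_inverse dihedral_one dihedral_inv dihedral_mul.
Proof.
by move=> [j c]; rewrite /dihedral_mul /= addbb; case: c; rewrite /= ?subrr ?addNr.
Qed.

HB.instance Definition _ := Finite_isGroup.Build (dihedral n)
  dihedral_mulA dihedral_mul1g dihedral_mulVg.

Definition d_rho : dihedral n := (1, false).
Definition d_refl : dihedral n := (0, true).

Lemma d_rhoX m : (d_rho ^+ m)%g = (m%:R, false).
Proof.
elim: m => [//|m IH]; rewrite expgS IH -[LHS]/(dihedral_mul _ _).
by rewrite /dihedral_mul /= -natr1 addrC.
Qed.

Lemma dihedralE g : g = (d_rho ^+ g.1 * d_refl ^+ g.2)%g.
Proof.
rewrite d_rhoX natr_Zp; case: g => j [] /=.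
  by rewrite expg1 -[RHS]/(dihedral_mul _ _) /dihedral_mul /= addr0.
by rewrite expg0 mulg1.
Qed.

Lemma dihedral_gen : <<[set d_rho; d_refl]>>%g = [set: dihedral n].
Proof.
apply/setP => g; rewrite inE (dihedralE g).
by rewrite groupM ?groupX ?mem_gen ?inE ?eqxx ?orbT.
Qed.

Lemma card_dihedral : (1 < n)%N -> #|{: dihedral n}| = (2 * n)%N.
Proof. by move=> n_gt1; rewrite card_prod card_bool card_ord Zp_cast // mulnC. Qed.

Definition is_reflection g : Prop :=
  exists j : nat, g = (d_rho ^+ j * d_refl)%g.

End DihedralGroup.

Section DihedralActionGroup.
Variables (k : fieldType) (n : nat).
Local Notation Q := (cyclic_quiver n).
Local Notation R := (preproj k Q).
Local Notation e := (@pp_vertex k Q).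
Local Notation al := (@pp_arrow k Q).
Local Notation als := (@pp_star k Q).
Implicit Types g h : dihedral n.

Definition dihedral_map g : {lrmorphism R -> R} :=
  lr_iter g.1 (@rho k n) \o lr_iter g.2 (@refl k n).

Lemma dihedral_mapE g x :
  dihedral_map g x = iter g.1 (@rho k n) (iter g.2 (@refl k n) x).
Proof. by rewrite /= !lr_iterE. Qed.

Lemma iter_rho_e m (i : 'Z_n) : iter m (@rho k n) (e i) = e (m%:R + i).
Proof. by elim: m => [|m IH] /=; rewrite ?add0r // IH rho_e addrAC -natr1. Qed.
Lemma iter_rho_al m (i : 'Z_n) : iter m (@rho k n) (al i) = al (m%:R + i).
Proof. by elim: m => [|m IH] /=; rewrite ?add0r // IH rho_al addrAC -natr1. Qed.
Lemma iter_rho_als m (i : 'Z_n) : iter m (@rho k n) (als i) = als (m%:R + i).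
Proof. by elim: m => [|m IH] /=; rewrite ?add0r // IH rho_als addrAC -natr1. Qed.

Lemma dihedral_map_e g (i : 'Z_n) :
  dihedral_map g (e i) = e (g.1 + (if g.2 then - i else i)).
Proof.
by case: g => j []; rewrite dihedral_mapE /= ?refl_e iter_rho_e natr_Zp.
Qed.

Lemma dihedral_map_al g (i : 'Z_n) :
  dihedral_map g (al i) =
  if g.2 then als (g.1 + (- i - 1)) else al (g.1 + i).
Proof.
case: g => j []; rewrite dihedral_mapE /=.
  by rewrite refl_al iter_rho_als natr_Zp.
by rewrite iter_rho_al natr_Zp.
Qed.

Lemma dihedral_map_als g (i : 'Z_n) :
  dihedral_map g (als i) =
  if g.2 then al (g.1 + (- i - 1)) else als (g.1 + i).
Proof.
case: g => j []; rewrite dihedral_mapE /=.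
  by rewrite refl_als iter_rho_al natr_Zp.
by rewrite iter_rho_als natr_Zp.
Qed.

Lemma dihedral_map1 x : dihedral_map 1%g x = x.
Proof. by rewrite dihedral_mapE. Qed.

Lemma dihedral_mapM g h x :
  dihedral_map (g * h)%g x = dihedral_map g (dihedral_map h x).
Proof.
have -> : (g * h)%g = dihedral_mul g h by [].
pose F : {lrmorphism R -> R} := dihedral_map g \o dihedral_map h.
rewrite -[RHS]/(F x); apply: pp_ext => i;
  rewrite -[RHS]/(dihedral_map g (dihedral_map h _)).
- rewrite !dihedral_map_e; congr e; case: g h {F} => [j []] [l []] /=;
  by rewrite ?opprD ?opprK !addrA.
- rewrite !dihedral_map_al (fun_if (dihedral_map g)) dihedral_map_al
    dihedral_map_als.
  case: g h {F} => [j []] [l []] /=;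
  first [apply: (congr1 al) | apply: (congr1 als)];
  by rewrite ?opprD ?opprK !addrA ?addrK.
- rewrite !dihedral_map_als (fun_if (dihedral_map g)) dihedral_map_al
    dihedral_map_als.
  case: g h {F} => [j []] [l []] /=;
  first [apply: (congr1 al) | apply: (congr1 als)];
  by rewrite ?opprD ?opprK !addrA ?addrK.
Qed.

Definition dihedral_action : alg_action (dihedral n) R :=
  AlgAction dihedral_map1 dihedral_mapM.

Lemma dihedral_action_rho x : dihedral_action (d_rho n) x = rho x.
Proof. exact: dihedral_mapE. Qed.
Lemma dihedral_action_refl x : dihedral_action (d_refl n) x = refl x.
Proof. exact: dihedral_mapE. Qed.

(* Together with [dihedral_gen], this identifies [dihedral n] with the group of
   automorphisms of R generated by rho and r. *)
Lemma dihedral_action_inj g h :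
  (2 < n)%N -> dihedral_action g =1 dihedral_action h -> g = h.
Proof.
move=> n_gt2 gh.
have ev (i : 'Z_n) : g.1 + (if g.2 then - i else i)
    = h.1 + (if h.2 then - i else i).
  by apply: (@pp_vertex_inj k Q); rewrite -!dihedral_map_e; exact: gh.
have e1 : g.1 = h.1.
  by have := ev 0; rewrite oppr0 !if_same !addr0.
have two : (1 : 'Z_n) != - 1.
  rewrite -subr_eq0 opprK; apply/eqP => /(congr1 val) /=.
  by rewrite !Zp_cast ?(ltnW n_gt2) // !(modn_small (ltnW n_gt2)) modn_small.
have := ev 1; rewrite e1 => /addrI; move: e1.
case: g {gh ev} => j b; case: h => l c /= ->.
by case: b; case: c => // /eqP; rewrite ?(negPf two) // eq_sym (negPf two).
Qed.

End DihedralActionGroup.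

(* Main.v *)
From HB Require Import structures.
Require Import Defs.
From mathcomp Require Import all_boot all_fingroup all_algebra.
From mathcomp Require Import boolp ring.

(** Let x be the sum of the arrows alpha_i and y the sum of the arrows
    alpha_i^*. In R they commute, x raises and y lowers the index of a vertex
    idempotent (e_i x = x e_{i+1}, e_{i+1} y = y e_i), and R is the direct sum
    of the right modules e_i k[x,y], each free of rank one over k[x,y]: this is
    a [cyclic_frame]. Rotations fix k[x,y] pointwise, and every reflection
    swaps x and y. The vertex-fixing reflections are the rho^{2i} r, so the
    claim is that the Auslander map is bijective exactly when one of these is
    missing from G ([auslander_bijP]).

    Injectivity always holds. If sum_g a_g g = 0 as an operator, evaluation at
    e_i and at e_i x gives A + B = 0 and A x + B y = 0, where A and B collect
    the rotations and the reflections; hence A (x - y) = 0 and A = B = 0.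

    If G contains all the rho^{2i} r, surjectivity fails because of a divided
    difference, as it does for the symmetric group of order 2 acting on k[x,y]:
    there is U with U(b) (x - y) = e_0 (b - r(b)), and rho o U is right
    R^G-linear but sends e_0 to 0 and e_0 x to e_1, which for an operator
    sum_g a_g g would force e_1 to lie in R (x - y).

    For the converse, let f be right R^G-linear and fix a vertex i. As k[x,y]
    is generated by 1 and x over the symmetric polynomials, which lie in R^G,
    there are M and N in R with f(e_i h) D = M h - N r(h) for all h in k[x,y],
    where D = x^n - y^n is central ([column_eq]). Linearity over the orbit sum
    of e_i x^n shows that M e_v vanishes unless rho^{v-i} is in G, and N e_v
    unless rho^{v+i} r is ([rot_coef_supp], [ref_coef_supp]). If D divides M
    and N on the right, the quotients are the coefficients of f. Divisibility
    ([ref_coef_div]) comes from separating supports. If rho^{2i} r is not in G,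
    the supports of M and N are disjoint, and M - N = f(e_i) D. Otherwise a
    missing rho^{2t} r forces rho^2 to be missing too; then N x and N y have
    disjoint supports, their difference is divisible by D, hence so is N x, and
    x is coprime to D. *)

Set Implicit Arguments.
Unset Strict Implicit.
Unset Printing Implicit Defensive.

Import GRing.Theory.
Local Open Scope ring_scope.

(** * Algebras with a cyclic frame over k[x,y] *)

(** The inner variable of {poly {poly k}} stands for y and the outer one for x.
    The field [frame_ind] says that the e_i x^c y^d span R; the functions
    [vcoef] j, which read off the polynomial h_j of b = sum_j e_j h_j, witness
    their linear independence. Linear functions on R are determined by their
    values on 1 and their behaviour under left multiplication by the generators,
    which is how [vcoef] is specified. *)
Record cyclic_frame (k : fieldType) (n : nat) (R : algType k) := CyclicFrame {
  vtx : 'Z_n -> R;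
  gx : R;
  gy : R;
  vtx_mul : forall i j, vtx i * vtx j = if i == j then vtx j else 0;
  vtx_sum : \sum_i vtx i = 1;
  vtx_gx : forall i, vtx i * gx = gx * vtx (i + 1);
  gy_vtx : forall i, gy * vtx i = vtx (i + 1) * gy;
  gx_gy : gx * gy = gy * gx;
  frame_ind : forall P : R -> Prop, (forall a b, P a -> P b -> P (a + b)) ->
    (forall t i c d, P (t *: (vtx i * (gx ^+ c * gy ^+ d)))) -> forall b, P b;
  vcoef : 'Z_n -> R -> {poly {poly k}};
  vcoefB : forall j, zmod_morphism (vcoef j);
  vcoef_scale : forall j c b, vcoef j (c *: b) = c%:P%:P * vcoef j b;
  vcoef_vtx : forall j i b, vcoef j (vtx i * b) = if i == j then vcoef j b else 0;
  vcoef_gx : forall j b, vcoef j (gx * b) = 'X * vcoef (j + 1) b;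
  vcoef_gy : forall j b, vcoef j (gy * b) = 'X%:P * vcoef (j - 1) b;
  vcoef1 : forall j, vcoef j 1 = 1
}.

Section Frame.
Variables (k : fieldType) (n : nat) (R : algType k) (S : cyclic_frame n R).
Local Notation e := (vtx S).
Local Notation x := (gx S).
Local Notation y := (gy S).
Local Notation P := {poly {poly k}}.
Implicit Types (i j v : 'Z_n) (a b : R) (p q : P).

HB.instance Definition _ j :=
  GRing.isZmodMorphism.Build R P (vcoef S j) (@vcoefB _ _ _ S j).

Lemma comm_gy_gx : commr_rmorph (horner_alg y) x.
Proof.
move=> p; rewrite /GRing.comm; elim/poly_ind: p => [|p c IH].
  by rewrite !raddf0 mulr0 mul0r.
rewrite !rmorphD !rmorphM /= !horner_algX !horner_algC mulrDr mulrDl.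
congr (_ + _); last by rewrite mulr_algl mulr_algr.
by rewrite mulrA IH -!mulrA gx_gy.
Qed.

(** Substitution of the commuting generators of R, an embedding of k[x,y]. *)
Definition ev : P -> R := horner_morph comm_gy_gx.
HB.instance Definition _ := GRing.RMorphism.on ev.

Lemma evX : ev 'X = x. Proof. exact: horner_morphX. Qed.
Lemma evC (p : {poly k}) : ev p%:P = horner_alg y p.
Proof. exact: horner_morphC. Qed.
Lemma evY : ev 'X%:P = y. Proof. by rewrite evC horner_algX. Qed.
Lemma evCC (c : k) : ev c%:P%:P = c%:A. Proof. by rewrite evC horner_algC. Qed.

Lemma evB p q : ev (p - q) = ev p - ev q.
Proof. exact: raddfB. Qed.

Lemma ev_comm p q : ev p * ev q = ev q * ev p.
Proof. by rewrite -!rmorphM mulrC. Qed.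

Lemma vcoef_ev j p : vcoef S j (ev p) = p.
Proof.
elim/poly_ind: p j => [|p c IH] j; first by rewrite !raddf0.
rewrite rmorphD rmorphM /= ev_comm evX raddfD /= vcoef_gx IH mulrC; congr (_ + _).
elim/poly_ind: c j => [|q t IHq] j; first by rewrite !raddf0.
rewrite polyCD polyCM rmorphD rmorphM /= ev_comm evY raddfD /= vcoef_gy IHq mulrC.
by congr (_ + _); rewrite evCC vcoef_scale vcoef1 mulr1.
Qed.

Lemma vcoef_vtx_ev j i p : vcoef S j (e i * ev p) = if i == j then p else 0.
Proof. by rewrite vcoef_vtx vcoef_ev. Qed.

(** Together with [vcoef_vtx_ev], this makes R a free right k[x,y]-module on the
    vertex idempotents, which reduces questions of divisibility in R to k[x,y],
    one coordinate at a time. *)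
Lemma vcoefK b : b = \sum_i e i * ev (vcoef S i b).
Proof.
elim/(@frame_ind _ _ _ S): b => [a b IHa IHb|t i c d].
  rewrite {1}IHa {1}IHb -big_split; apply: eq_bigr => i _.
  by rewrite /= raddfD rmorphD mulrDr.
rewrite (_ : x ^+ c * y ^+ d = ev ('X ^+ c * 'X%:P ^+ d)); last first.
  by rewrite rmorphM !rmorphXn /= evX evY.
rewrite (bigD1 i) //= vcoef_scale vcoef_vtx_ev eqxx big1 => [|j ne].
  by rewrite addr0 [in RHS]rmorphM /= evCC mulr_algl scalerAr.
by rewrite vcoef_scale vcoef_vtx_ev eq_sym (negPf ne) mulr0 raddf0 mulr0.
Qed.

Lemma vcoef_inj a b : (forall j, vcoef S j a = vcoef S j b) -> a = b.
Proof.
by move=> ab; rewrite (vcoefK a) (vcoefK b); apply: eq_bigr => i _; rewrite ab.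
Qed.

Lemma vtx_vcoef i b : e i * b = e i * ev (vcoef S i b).
Proof.
apply: vcoef_inj => j; rewrite vcoef_vtx vcoef_vtx_ev.
by case: eqP => [->|].
Qed.

Lemma vcoef_mulr j b p : vcoef S j (b * ev p) = vcoef S j b * p.
Proof.
rewrite [in LHS](vcoefK b) mulr_suml raddf_sum (bigD1 j) //= big1 => [|i /negPf ne].
  by rewrite -mulrA -rmorphM /= vcoef_vtx_ev eqxx addr0.
by rewrite -mulrA vcoef_vtx ne.
Qed.

(** R is torsion free on the right over the domain k[x,y]. *)
Lemma ev_reg p b : p != 0 -> b * ev p = 0 -> b = 0.
Proof.
move=> p0 bp; apply: vcoef_inj => j; move/(congr1 (vcoef S j)): bp.
rewrite vcoef_mulr raddf0 => /eqP; rewrite mulf_eq0 (negPf p0) orbF.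
by move/eqP.
Qed.

Lemma ev_regI p a b : p != 0 -> a * ev p = b * ev p -> a = b.
Proof.
move=> p0 E; apply/eqP; rewrite -subr_eq0; apply/eqP/(ev_reg p0).
by rewrite mulrBl E subrr.
Qed.

Lemma vtx_gxX i m : e i * x ^+ m = x ^+ m * e (i + m%:R).
Proof.
elim: m i => [|m IH] i; first by rewrite !expr0 mulr1 mul1r addr0.
by rewrite exprS mulrA vtx_gx -mulrA IH mulrA -exprS -addrA -nat1r.
Qed.
Lemma gyX_vtx i m : y ^+ m * e i = e (i + m%:R) * y ^+ m.
Proof.
elim: m i => [|m IH] i; first by rewrite !expr0 mulr1 mul1r addr0.
by rewrite exprSr -mulrA gy_vtx mulrA IH -mulrA -exprSr -addrA -nat1r.
Qed.

Lemma vtx_ev_comm b :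
  (forall i, e i * b = b * e i) -> (forall p, ev p * b = b * ev p) ->
  forall a, a * b = b * a.
Proof.
move=> eb pb a; rewrite (vcoefK a) mulr_suml mulr_sumr; apply: eq_bigr => i _.
by rewrite -mulrA pb !mulrA eb.
Qed.

Hypothesis n_gt1 : (1 < n)%N.

(** Moving past x^n turns the vertex index n times around the cycle. *)
Lemma gxn_central a : a * x ^+ n = x ^+ n * a.
Proof.
apply: vtx_ev_comm => [i|p]; first by rewrite vtx_gxX pchar_Zp // addr0.
by rewrite -evX -rmorphXn ev_comm.
Qed.

Lemma gyn_central a : a * y ^+ n = y ^+ n * a.
Proof.
apply: vtx_ev_comm => [i|p]; first by rewrite gyX_vtx pchar_Zp // addr0.
by rewrite -evY -rmorphXn ev_comm.
Qed.

End Frame.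

(** * The dihedral action *)
Record dihedral_compat (k : fieldType) (n : nat) (R : algType k)
    (S : cyclic_frame n R) (to : alg_action (dihedral n) R) : Prop :=
  DihedralCompat {
  to_vtx : forall g i, to g (vtx S i) = vtx S (g.1 + (if g.2 then - i else i));
  to_gx : forall g, to g (gx S) = if g.2 then gy S else gx S;
  to_gy : forall g, to g (gy S) = if g.2 then gx S else gy S
}.

Definition drot {n} (c : 'Z_n) : dihedral n := (c, false).
Definition dref {n} (c : 'Z_n) : dihedral n := (c, true).

Section DihedralMul.
Variable n : nat.
Implicit Types c d : 'Z_n.

Lemma drotM c d : (drot c * drot d)%g = drot (c + d).
Proof. by []. Qed.
Lemma drefM c d : (dref c * dref d)%g = drot (c - d).
Proof. by []. Qed.
Lemma drot_drefM c d : (drot c * dref d)%g = dref (c + d).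
Proof. by []. Qed.
Lemma dref_drotM c d : (dref c * drot d)%g = dref (c - d).
Proof. by []. Qed.

Lemma sum_dihedral (V : zmodType) (F : dihedral n -> V) :
  \sum_g F g = \sum_c F (drot c) + \sum_c F (dref c).
Proof.
transitivity (\sum_(p : 'Z_n * bool) F (p.1, p.2)).
  by apply: (@eq_bigr _ _ _ _ (index_enum ('Z_n * bool)%type)) => -[].
rewrite -(pair_bigA _ (fun c b => F (c, b))) -big_split /=.
by apply: eq_bigr => c _; rewrite big_bool addrC.
Qed.

End DihedralMul.

Section Action.
Variables (k : fieldType) (n : nat) (R : algType k) (S : cyclic_frame n R).
Variables (to : alg_action (dihedral n) R) (toS : dihedral_compat S to).
Local Notation e := (vtx S).
Local Notation x := (gx S).
Local Notation y := (gy S).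
Local Notation ev := (ev S).
Local Notation P := {poly {poly k}}.
Implicit Types (i j v c : 'Z_n) (a b : R) (p q : P).

Lemma drot_vtx c i : to (drot c) (e i) = e (c + i). Proof. exact: to_vtx. Qed.
Lemma dref_vtx c i : to (dref c) (e i) = e (c - i). Proof. exact: to_vtx. Qed.

Lemma drot_ev c p : to (drot c) (ev p) = ev p.
Proof.
elim/poly_ind: p => [|p t IH]; first by rewrite !raddf0.
rewrite !rmorphD !rmorphM /= IH evX (to_gx toS) /=; congr (_ + _).
elim/poly_ind: t => [|q t IHq]; first by rewrite !raddf0.
rewrite polyCD polyCM !rmorphD !rmorphM /= IHq evY (to_gy toS) /=.
by rewrite evCC linearZ /= rmorph1.
Qed.

(** The reflections differ by rotations, which are trivial on k[x,y]. *)
Lemma dref_ev c p : to (dref c) (ev p) = to (dref 0) (ev p).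
Proof.
have -> : dref c = (dref 0 * drot (- c))%g by rewrite dref_drotM opprK add0r.
by rewrite aactM drot_ev.
Qed.

(** Symmetry of a polynomial, expressed through the action of r on its value so
    that invariance under G follows at once. *)
Definition swap_inv (s : P) : Prop := to (dref 0) (ev s) = ev s.

Lemma swap_invD s t : swap_inv s -> swap_inv t -> swap_inv (s + t).
Proof. by rewrite /swap_inv => ss st; rewrite !rmorphD /= ss st. Qed.
Lemma swap_invM s t : swap_inv s -> swap_inv t -> swap_inv (s * t).
Proof. by rewrite /swap_inv => ss st; rewrite !rmorphM /= ss st. Qed.
Lemma swap_invN s : swap_inv s -> swap_inv (- s).
Proof. by rewrite /swap_inv => ss; rewrite (raddfN ev) (raddfN (to _)) /= ss. Qed.
Lemma swap_invC (c : k) : swap_inv c%:P%:P.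
Proof. by rewrite /swap_inv evCC linearZ /= rmorph1. Qed.
Lemma swap_inv_add : swap_inv ('X + 'X%:P).
Proof. by rewrite /swap_inv !rmorphD /= evX evY (to_gx toS) (to_gy toS) addrC. Qed.
Lemma swap_inv_mul : swap_inv ('X * 'X%:P).
Proof.
by rewrite /swap_inv !rmorphM /= evX evY (to_gx toS) (to_gy toS) gx_gy.
Qed.

(** k[x,y] is generated by 1 and x over the symmetric polynomials: use
    x^2 = (x + y) x - x y and y = (x + y) - x to lower powers. *)
Lemma swap_inv_decomp p : exists s t, [/\ swap_inv s, swap_inv t & p = s + t * 'X].
Proof.
elim/poly_ind: p => [|p c [s [t [ss st ->]]]].
  exists 0, 0; rewrite /swap_inv !raddf0; split=> //; by rewrite mul0r addr0.
have [u [w [su sw ->]]]: exists u w, [/\ swap_inv u, swap_inv w & c%:P = u + w * 'X].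
  elim/poly_ind: c => [|c d [u [w [su sw E]]]].
    exists 0, 0; rewrite /swap_inv !raddf0; split=> //; by rewrite mul0r addr0.
  exists (u * ('X + 'X%:P) + w * ('X * 'X%:P) + d%:P%:P), (- u); split.
  - by apply: swap_invD (swap_invC d); apply: swap_invD; apply: swap_invM => //;
      [exact: swap_inv_add|exact: swap_inv_mul].
  - exact: swap_invN.
  rewrite polyCD polyCM E [(d%:P)%:P]lock; ring.
exists (u - t * ('X * 'X%:P)), (s + t * ('X + 'X%:P) + w); split.
- apply: swap_invD => //; apply: swap_invN.
  by apply: swap_invM => //; exact: swap_inv_mul.
- apply: swap_invD => //; apply: swap_invD => //.
  by apply: swap_invM => //; exact: swap_inv_add.
ring.
Qed.

End Action.

(** * Injectivity of the Auslander map *)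
Section AuslanderMap.
Variables (k : fieldType) (n : nat) (R : algType k) (S : cyclic_frame n R).
Variables (to : alg_action (dihedral n) R) (toS : dihedral_compat S to).
Hypothesis n_gt1 : (1 < n)%N.
Variable G : {group dihedral n}.
Local Notation e := (vtx S).
Local Notation x := (gx S).
Local Notation y := (gy S).
Local Notation ev := (ev S).
Local Notation P := {poly {poly k}}.
Implicit Types (i j v c : 'Z_n) (a b : R) (p q : P).

Lemma sub_gxy_ev : x - y = ev ('X - 'X%:P).
Proof. by rewrite evB evX evY. Qed.

Lemma gxy_reg b : b * (x - y) = 0 -> b = 0.
Proof. by rewrite sub_gxy_ev; apply: ev_reg; rewrite polyXsubC_eq0. Qed.

Lemma gxy_regI a b : a * (x - y) = b * (x - y) -> a = b.
Proof.
move=> E; apply/eqP; rewrite -subr_eq0; apply/eqP/gxy_reg.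
by rewrite mulrBl E subrr.
Qed.

Lemma mulr_sum_vtx b : b = \sum_i b * e i.
Proof. by rewrite -mulr_sumr vtx_sum mulr1. Qed.

(** Extension by zero, so that operators can be summed over the whole dihedral
    group, split into rotations and reflections. *)
Definition skew_ext (z : Defs.skew to G) (g : dihedral n) : R :=
  if g \in G then z (subg G g) else 0.

Lemma auslander_ext z b :
  auslander to G z b = \sum_g skew_ext z g * to g b.
Proof.
rewrite /= /auslander_fun /skew_ext.
rewrite (bigID (mem G)) /= [X in _ + X]big1 ?addr0; last first.
  by move=> g /negPf ->; rewrite mul0r.
rewrite (reindex_onto (@sgval _ G) (subg G)) /=; last exact: subgK.
by apply: eq_big => [h|h _]; rewrite subgP sgvalK ?eqxx.
Qed.

Section Coefficients.
Variable al : dihedral n -> R.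
(** The contributions of rotations and of reflections to the value at e_i. *)
Definition rot_part i := \sum_c al (drot c) * e (c + i).
Definition ref_part i := \sum_c al (dref c) * e (c - i).

Lemma sum_act_vtx i p : \sum_g al g * to g (e i * ev p) =
  rot_part i * ev p + ref_part i * to (dref 0) (ev p).
Proof.
rewrite sum_dihedral !mulr_suml; congr (_ + _); apply: eq_bigr => c _.
  by rewrite rmorphM /= (drot_vtx toS) (drot_ev toS) mulrA.
by rewrite rmorphM /= (dref_vtx toS) (dref_ev toS) mulrA.
Qed.

Lemma rot_part_vtx i c : rot_part i * e (c + i) = al (drot c) * e (c + i).
Proof.
rewrite mulr_suml (bigD1 c) //= -mulrA vtx_mul eqxx big1 ?addr0 // => d ne.
by rewrite -mulrA vtx_mul (inj_eq (addIr _)) (negPf ne) mulr0.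
Qed.

Lemma ref_part_vtx i c : ref_part i * e (c - i) = al (dref c) * e (c - i).
Proof.
rewrite mulr_suml (bigD1 c) //= -mulrA vtx_mul eqxx big1 ?addr0 // => d ne.
by rewrite -mulrA vtx_mul (inj_eq (addIr _)) (negPf ne) mulr0.
Qed.

Lemma sum_act_vtx1 i : \sum_g al g * to g (e i) = rot_part i + ref_part i.
Proof.
by have := sum_act_vtx i 1; rewrite rmorph1 rmorph1 !mulr1.
Qed.

Lemma sum_act_vtxX i :
  \sum_g al g * to g (e i * x) = rot_part i * x + ref_part i * y.
Proof. by have := sum_act_vtx i 'X; rewrite evX (to_gx toS). Qed.

(** A reflection and a rotation that agree on a vertex are told apart by x, as
    x - y is regular. *)
Lemma act_coef_inj : (forall b, \sum_g al g * to g b = 0) -> forall g, al g = 0.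
Proof.
move=> al0.
have AB i : rot_part i = - ref_part i.
  by apply/eqP; rewrite -addr_eq0 -sum_act_vtx1 al0.
have B0 i : ref_part i = 0.
  apply: gxy_reg; apply: oppr_inj; rewrite oppr0 -(al0 (e i * x)) sum_act_vtxX.
  by rewrite AB mulrBr opprB addrC mulNr.
have A0 i : rot_part i = 0 by rewrite AB B0 oppr0.
case=> c []; rewrite [LHS]mulr_sum_vtx big1 // => i _.
- by have := ref_part_vtx (c - i) c; rewrite B0 mul0r subKr => <-.
- by have := rot_part_vtx (i - c) c; rewrite A0 mul0r addrC subrK => <-.
Qed.

End Coefficients.

Lemma auslander_inj : injective (auslander to G).
Proof.
move=> z w zw; apply/eqP; rewrite -subr_eq0; apply/eqP/ffunP => g.
have /act_coef_inj/(_ (sgval g)) : forall b, \sum_g skew_ext (z - w) g * to g b = 0.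
  have zw0 : auslander to G (z - w) = 0.
    by apply/eqP; rewrite raddfB subr_eq0; apply/eqP.
  by move=> b; rewrite -auslander_ext zw0.
by rewrite /skew_ext subgP sgvalK => ->; rewrite ffunE.
Qed.

(** * Failure of surjectivity when all vertex-fixing reflections lie in G *)
Lemma gx_drot b : x * to (drot 1) b = b * x.
Proof.
rewrite [in RHS](vcoefK S b) [in LHS](vcoefK S b) raddf_sum mulr_sumr mulr_suml.
apply: eq_bigr => i _ /=.
rewrite rmorphM /= (drot_vtx toS) (drot_ev toS) mulrA addrC -vtx_gx -!mulrA.
by rewrite -evX ev_comm.
Qed.

Lemma gy_drot b : y * b = to (drot 1) b * y.
Proof.
rewrite [in RHS](vcoefK S b) [in LHS](vcoefK S b) raddf_sum mulr_sumr mulr_suml.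
apply: eq_bigr => i _ /=.
rewrite rmorphM /= (drot_vtx toS) (drot_ev toS) mulrA gy_vtx addrC -!mulrA.
by rewrite -evY ev_comm.
Qed.

(** If e_0 b = e_0 (s + t x) with s and t symmetric, the quotient is e_0 t: this
    is the divided difference of the component of b at the vertex 0. *)
Lemma exists_demazure b :
  exists u, u * (x - y) = e 0 * (b - to (dref 0) b).
Proof.
have [s [t [ss st E]]] := swap_inv_decomp toS (vcoef S 0 b).
have r0 : to (dref 0) (e 0) = e 0 by rewrite (dref_vtx toS) subr0.
have rE : e 0 * to (dref 0) b = e 0 * to (dref 0) (ev (vcoef S 0 b)).
  by have := congr1 (to (dref 0)) (vtx_vcoef S 0 b); rewrite !rmorphM /= r0.
exists (e 0 * ev t); rewrite [RHS]mulrBr rE (vtx_vcoef S 0 b) E.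
rewrite -mulrBr -mulrA; congr (_ * _).
rewrite rmorphD rmorphM /= rmorphD rmorphM /= ss st evX (to_gx toS) /=.
by rewrite opprD addrACA subrr add0r mulrBr.
Qed.

(** The operator U of divided differences lowers the degree by one, hence it is
    linear over R^G only up to a shift by rho: U(b s) = U(b) rho(s). Composition
    with rho repairs this, because rho^2 lies in G and so fixes s. *)
Lemma auslander_not_surj : (forall i, dref (i + i) \in G) ->
  exists T : right_end (fixed_ring to G), forall z, auslander to G z <> T.
Proof.
move=> refG; have [U UE] := choice exists_demazure.
have r0G : dref 0 \in G by have := refG 0; rewrite addr0.
have rho2G : drot (1 + 1) \in G.
  by rewrite -[1 + 1]subr0 -drefM groupM.
have UD a b : U (a + b) = U a + U b.
  apply: gxy_regI; rewrite mulrDl !UE -mulrDr raddfD; congr (_ * _).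
  by rewrite opprD addrACA.
(* An invariant s passes x - y as rho(s): both rho and its inverse act alike. *)
have UM b s : s \in fixed_ring to G -> U (b * s) = U b * to (drot 1) s.
  move=> /fixed_ringP sG; apply: gxy_regI; rewrite UE rmorphM /= sG //.
  rewrite -mulrBl mulrA -UE -!mulrA; congr (_ * _).
  rewrite mulrBl mulrBr -gx_drot -aactM drotM sG //; congr (_ - _).
  by rewrite -gy_drot.
pose T b := to (drot 1) (U b).
have TR : T \in right_linear_pred (fixed_ring to G).
  apply/right_linearP; split=> [a b|b s sR]; rewrite /T ?UD ?raddfD //.
  rewrite UM // rmorphM /= -aactM drotM.
  by have /fixed_ringP -> := sR.
exists (RightEnd TR) => z zT.
have ET b : \sum_g skew_ext z g * to g b = T b by rewrite -auslander_ext zT.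
have U0 : U (e 0) = 0.
  by apply: gxy_reg; rewrite UE (dref_vtx toS) subr0 subrr mulr0.
have Ux : U (e 0 * x) = e 0.
  apply: gxy_regI; rewrite UE rmorphM /= (to_gx toS) (dref_vtx toS) subr0 /=.
  by rewrite -mulrBr mulrA vtx_mul eqxx.
have AB : ref_part (skew_ext z) 0 = - rot_part (skew_ext z) 0.
  by apply/eqP; rewrite -addr_eq0 addrC -sum_act_vtx1 ET /T U0 raddf0.
have := sum_act_vtxX (skew_ext z) 0.
rewrite ET /T Ux AB (drot_vtx toS) addr0 mulNr -mulrBr sub_gxy_ev.
(* Now e_1 = A (x - y); compare constant terms in the coordinate at 1. *)
move/(congr1 (fun b => (vcoef S 1 b).[0].[0])).
rewrite vcoef_mulr -[e 1]mulr1 vcoef_vtx eqxx vcoef1 !hornerE /= oppr0 mulr0.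
by move/eqP; rewrite oner_eq0.
Qed.

(** * Columns of R^G-linear operators *)

(** The values of these polynomials in R are central, as x^n and y^n are. *)
Definition xyn_comb (c d : k) : P := c%:P%:P * 'X ^+ n + d%:P%:P * 'X%:P ^+ n.

Lemma ev_xyn_combE (c d : k) : ev (xyn_comb c d) = c *: x ^+ n + d *: y ^+ n.
Proof.
by rewrite rmorphD !rmorphM /= !evCC !rmorphXn /= evX evY !mulr_algl.
Qed.

Lemma xyn_combB (c d c' d' : k) :
  xyn_comb c d - xyn_comb c' d' = xyn_comb (c - c') (d - d').
Proof. rewrite /xyn_comb !polyCB; ring. Qed.

Lemma xyn_comb_neq0 (c d : k) : (c != 0) || (d != 0) -> xyn_comb c d != 0.
Proof.
have n0 : (n == 0)%N = false by case: (n) n_gt1.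
rewrite -negb_and; apply: contra => /eqP E.
(* c is the coefficient of x^n, and d y^n the constant term in x. *)
have coefE m : (xyn_comb c d)`_m =
    c%:P * (m == n)%:R + (d%:P * 'X^n *+ (m == 0)).
  rewrite /xyn_comb -(rmorphXn polyC) -[in X in _ + X]polyCM.
  rewrite coefD coefCM coefXn coefC.
  by case: (m == 0).
apply/andP; split; rewrite -(@polyC_eq0 k).
  by have := coefE n; rewrite E coef0 eqxx n0 mulr1 addr0 => <-.
have := coefE 0; rewrite E coef0 eq_sym n0 mulr0 add0r eqxx mulr1n.
by move/esym/eqP; rewrite mulf_eq0 expf_eq0 polyX_eq0 andbF orbF.
Qed.

Lemma ev_xyn_comb (c d : k) a : a * ev (xyn_comb c d) = ev (xyn_comb c d) * a.
Proof.
rewrite ev_xyn_combE mulrDr mulrDl -!scalerAr -!scalerAl.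
by rewrite gxn_central // gyn_central.
Qed.

Lemma dref_xyn_comb (c d : k) :
  to (dref 0) (ev (xyn_comb c d)) = ev (xyn_comb d c).
Proof.
rewrite !ev_xyn_combE raddfD /= !linearZ /= !rmorphXn /=.
by rewrite (to_gx toS) (to_gy toS) addrC.
Qed.

Lemma swap_inv_fixed s : swap_inv S to s -> ev s \in fixed_ring to G.
Proof.
move=> ss; apply/fixed_ringP => -[c []] _; first by rewrite (dref_ev toS).
exact: drot_ev.
Qed.

Lemma dref_ev_ex p : exists q, to (dref 0) (ev p) = ev q.
Proof.
have [s [t [ss st ->]]] := swap_inv_decomp toS p.
exists (s + t * 'X%:P).
by rewrite !rmorphD !rmorphM /= ss st evX evY (to_gx toS).
Qed.

(** x is coprime to D = x^n - y^n: modulo x, the latter is - y^n. *)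
Lemma gx_cancel_div a b : a * x = b * ev (xyn_comb 1 (-1)) ->
  exists h, a = h * ev (xyn_comb 1 (-1)).
Proof.
move=> E.
have /choice[h hE] : forall j, exists q, vcoef S j a = q * xyn_comb 1 (-1).
  move=> j; move/(congr1 (vcoef S j)): E; rewrite -evX !vcoef_mulr.
  elim/poly_ind: (vcoef S j b) => [|q c _].
    rewrite mul0r => /eqP; rewrite mulf_eq0 polyX_eq0 orbF => /eqP ->.
    by exists 0; rewrite mul0r.
  move=> E.
  have c0 : c = 0.
    move/(congr1 (horner^~ 0)): E; rewrite !hornerE /=; move/esym/eqP.
    rewrite expr0n gtn_eqF ?(ltnW n_gt1) // add0r !mulf_eq0 polyC_eq0 oppr_eq0.
    by rewrite oner_eq0 expf_eq0 polyX_eq0 andbF !orbF => /eqP.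
  exists q; apply: (@mulIf _ 'X); rewrite ?polyX_eq0 // E c0 addr0.
  ring.
exists (\sum_j e j * ev (h j)); apply: (@vcoef_inj _ _ _ S) => j.
rewrite hE vcoef_mulr raddf_sum (bigD1 j) //= vcoef_vtx_ev eqxx.
by rewrite big1 ?addr0 // => l /negPf ne; rewrite vcoef_vtx_ev ne.
Qed.

(** The restriction of f to e_i R, for an additive f that commutes with right
    multiplication by R^G. *)
Section Column.
Variables (f : R -> R) (i : 'Z_n).
Hypothesis fD : forall a b, f (a + b) = f a + f b.
Hypothesis fM : forall b s, s \in fixed_ring to G -> f (b * s) = f b * s.

Let M0 := f (e i * x) - f (e i) * y.
Let N0 := f (e i * x) - f (e i) * x.

(** Writing p = s + t x with s and t symmetric, f(e_i p) = f(e_i) s + f(e_i x) t;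
    the formula expresses s (x - y) and t (x - y) through p and r(p). *)
Lemma column_diff p :
  f (e i * ev p) * (x - y) = M0 * ev p - N0 * to (dref 0) (ev p).
Proof.
have [s [t [ss st ->]]] := swap_inv_decomp toS p.
have -> : to (dref 0) (ev (s + t * 'X)) = ev (s + t * 'X%:P).
  by rewrite !rmorphD !rmorphM /= ss st evX evY (to_gx toS).
have -> : f (e i * ev (s + t * 'X)) = f (e i) * ev s + f (e i * x) * ev t.
  rewrite rmorphD rmorphM /= ev_comm evX mulrDr fD mulrA.
  by rewrite (fM _ (swap_inv_fixed ss)) (fM _ (swap_inv_fixed st)).
rewrite sub_gxy_ev /M0 /N0; set F := f (e i); set Fx := f (e i * x).
rewrite -(evX S) -(evY S) !mulrBl mulrDl -!mulrA -!rmorphM /=.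
have -> : s * ('X - 'X%:P) = 'X * (s + t * 'X%:P) - 'X%:P * (s + t * 'X) by ring.
have -> : t * ('X - 'X%:P) = (s + t * 'X) - (s + t * 'X%:P) by ring.
rewrite !evB !mulrBr opprB.
by rewrite addrACA [RHS]addrACA [F * _ + _]addrC.
Qed.

(* The cofactor of x - y in x^n - y^n, used to trade the denominator x - y for a
   central one. *)
Let quot_poly : P := \sum_(l < n) 'X ^+ (n.-1 - l) * 'X%:P ^+ l.
Let M := M0 * ev quot_poly.
Let N := N0 * ev quot_poly.
Local Notation D := (ev (xyn_comb 1 (-1))).

Lemma quot_polyE : ev (xyn_comb 1 (-1)) = (x - y) * ev quot_poly.
Proof.
rewrite sub_gxy_ev -rmorphM /= /quot_poly -subrXX; congr ev.
rewrite /xyn_comb !polyC1 !polyCN !polyC1; ring.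
Qed.

Lemma D_regI a b : a * D = b * D -> a = b.
Proof. by apply: ev_regI; apply: xyn_comb_neq0; rewrite oner_eq0. Qed.

Lemma D_reg a : a * D = 0 -> a = 0.
Proof. by apply: ev_reg; apply: xyn_comb_neq0; rewrite oner_eq0. Qed.

Lemma column_eq p :
  f (e i * ev p) * D = M * ev p - N * to (dref 0) (ev p).
Proof.
rewrite quot_polyE mulrA column_diff mulrBl /M /N.
have [q ->] := dref_ev_ex p.
by rewrite -!mulrA ![ev quot_poly * _]ev_comm.
Qed.

Lemma column_vtx : f (e i) * D = M - N.
Proof. by have := column_eq 1; rewrite !rmorph1 !mulr1. Qed.

(* The orbit sum of e_i x^n is diagonal; its entry at v has the term x^n or y^n
   according to whether the rotation or the reflection that takes i to v is
   in G. *)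
Let orbit_weight v := xyn_comb (drot (v - i) \in G)%:R (dref (v + i) \in G)%:R.
Let orbit_sum := \sum_(g in G) to g (e i * x ^+ n).

Lemma orbit_sum_fixed : orbit_sum \in fixed_ring to G.
Proof.
apply/fixed_ringP => g gG; rewrite raddf_sum /= [RHS](reindex_inj (mulgI g)) /=.
by apply: eq_big => [h|h _]; rewrite ?groupMl // aactM.
Qed.

Lemma orbit_sumE : orbit_sum = \sum_v ev (orbit_weight v) * e v.
Proof.
rewrite /orbit_sum big_mkcond sum_dihedral /=.
rewrite (reindex_inj (addIr (- i))) [X in _ + X](reindex_inj (addIr i)) /=.
rewrite -big_split; apply: eq_bigr => v _ /=.
rewrite -ev_xyn_comb ev_xyn_combE mulrDr.
congr (_ + _).
  rewrite rmorphM rmorphXn /= (drot_vtx toS) (to_gx toS) subrK -scalerAr.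
  by case: ifP; rewrite ?scale1r ?scale0r.
rewrite rmorphM rmorphXn /= (dref_vtx toS) (to_gx toS) addrK -scalerAr.
by case: ifP; rewrite ?scale1r ?scale0r.
Qed.

Lemma orbit_sum_vtx v : orbit_sum * e v = ev (orbit_weight v) * e v.
Proof.
rewrite orbit_sumE mulr_suml (bigD1 v) //= -mulrA vtx_mul eqxx.
rewrite big1 ?addr0 // => j ne.
by rewrite -mulrA vtx_mul (negPf ne) mulr0.
Qed.

Lemma vtx_orbit_sum : e i * orbit_sum = e i * ev (orbit_weight i).
Proof.
rewrite orbit_sumE mulr_sumr (bigD1 i) //= -!ev_xyn_comb mulrA vtx_mul eqxx.
rewrite big1 ?addr0 // => j ne.
by rewrite -ev_xyn_comb mulrA vtx_mul eq_sym (negPf ne) mul0r.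
Qed.

(** Both sides of f(e_i h) q = f(e_i h q), for the orbit sum q, are of the form
    M' h - N' r(h). Varying h among combinations of x^n and y^n, which are
    central and exchanged by r, separates M' from N'. *)
Lemma orbit_sum_swap :
  M * orbit_sum = M * ev (orbit_weight i) /\
  N * orbit_sum = N * to (dref 0) (ev (orbit_weight i)).
Proof.
have fq a : f (a * orbit_sum) = f a * orbit_sum.
  by apply: fM; exact: orbit_sum_fixed.
pose a := M * orbit_sum - M * ev (orbit_weight i).
pose b := N * orbit_sum - N * to (dref 0) (ev (orbit_weight i)).
have Eq (s t : k) : a * ev (xyn_comb s t) = b * ev (xyn_comb t s).
  have E1 : e i * ev (orbit_weight i * xyn_comb s t) =
      e i * ev (xyn_comb s t) * orbit_sum.
    by rewrite rmorphM /= mulrA -vtx_orbit_sum -mulrA ev_xyn_comb mulrA.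
  have := column_eq (orbit_weight i * xyn_comb s t).
  rewrite E1 fq -[_ * orbit_sum * _]mulrA [orbit_sum * _]ev_xyn_comb mulrA.
  rewrite column_eq rmorphM rmorphM /= dref_xyn_comb mulrBl.
  rewrite -[M * _ * orbit_sum]mulrA -[N * _ * orbit_sum]mulrA.
  rewrite -!(ev_xyn_comb _ _ orbit_sum) !mulrA.
  rewrite /a /b !mulrBl.
  set P1 := M * orbit_sum * _; set P2 := M * _ * _.
  set Q1 := N * orbit_sum * _; set Q2 := N * _ * _.
  move/eqP; rewrite subr_eq => /eqP ->.
  by rewrite [P2 - Q2]addrC -!addrA [P2 + _]addrC subrK addrC.
(* h = x^n + y^n gives a = b, then h = x^n gives a x^n = a y^n. *)
have ab : a = b.
  have X0 : xyn_comb 1 1 != 0 by apply: xyn_comb_neq0; rewrite oner_eq0.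
  exact: (ev_regI X0 (Eq 1 1)).
have a0 : a = 0.
  apply: D_reg; have := Eq 1 0; rewrite -ab => E.
  have -> : xyn_comb 1 (-1) = xyn_comb 1 0 - xyn_comb 0 1.
    by rewrite xyn_combB subr0 sub0r.
  by rewrite raddfB mulrBr /= E subrr.
by split; apply/eqP; rewrite -subr_eq0 -/a -/b -?ab a0.
Qed.

(** The entry of the orbit sum at i contains x^n, as 1 is in G; at v it does not
    when the rotation from i to v is missing, so the two entries differ. *)
Lemma rot_coef_supp v : drot (v - i) \notin G -> M * e v = 0.
Proof.
move=> vG; have [E _] := orbit_sum_swap.
have : M * e v * ev (orbit_weight v) = M * e v * ev (orbit_weight i).
  by rewrite -!mulrA !ev_xyn_comb -orbit_sum_vtx !mulrA E.
move/eqP; rewrite eq_sym -subr_eq0 -mulrBr -raddfB /= /orbit_weight xyn_combB.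
rewrite subrr group1 (negPf vG) subr0 => /eqP; apply: ev_reg; apply: xyn_comb_neq0.
by rewrite oner_eq0.
Qed.

(** As for M, with the entry at i replaced by its swap, which contains y^n. *)
Lemma ref_coef_supp v : dref (v + i) \notin G -> N * e v = 0.
Proof.
move=> vG; have [_ E] := orbit_sum_swap.
have : N * e v * ev (orbit_weight v) =
    N * e v * to (dref 0) (ev (orbit_weight i)).
  rewrite dref_xyn_comb -!mulrA !ev_xyn_comb -orbit_sum_vtx !mulrA E.
  by rewrite dref_xyn_comb.
move/eqP; rewrite eq_sym -subr_eq0 dref_xyn_comb -mulrBr -raddfB /= xyn_combB.
rewrite subrr group1 (negPf vG) subr0 => /eqP; apply: ev_reg; apply: xyn_comb_neq0.
by rewrite oner_eq0 orbT.
Qed.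

(** The component at v + 1 of N (x - y) = N0 D: x carries e_v and y carries
    e_{v+2} there. *)
Lemma ref_coef_shift v :
  N * e v * x - N * e (v + 1 + 1) * y = N0 * e (v + 1) * D.
Proof.
rewrite -!mulrA vtx_gx -gy_vtx !mulrA -mulrBl -mulrBr -!mulrA ev_xyn_comb.
rewrite quot_polyE.
rewrite !mulrA /N; congr (_ * _); rewrite -!mulrA; congr (_ * _).
by rewrite sub_gxy_ev ev_comm.
Qed.

(** In each case at most one of two terms whose difference is a multiple of D is
    nonzero: M e_v and N e_v if rho^{2i} r is not in G, and otherwise N e_v x
    and N e_{v+2} y, since rho^2 is not in G. *)
Lemma ref_coef_div (t : 'Z_n) :
  dref (t + t) \notin G -> forall v, exists h, N * e v = h * D.
Proof.
move=> tG v.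
have [vG|vG] := boolP (dref (v + i) \in G); last first.
  by exists 0; rewrite ref_coef_supp // mul0r.
have [iG|iG] := boolP (dref (i + i) \in G); last first.
  exists (- (f (e i) * e v)).
  rewrite mulNr -[f _ * _ * _]mulrA ev_xyn_comb [_ * (D * _)]mulrA.
  rewrite column_vtx mulrBl opprB rot_coef_supp ?subr0 //.
  apply: contra iG => vG'.
  have -> : dref (i + i) = ((drot (v - i))^-1 * dref (v + i))%g.
    rewrite -[((drot (v - i))^-1)%g]/(drot (- (v - i))) drot_drefM.
    congr dref; ring.
  by rewrite groupM ?groupV.
(* rho^{2t} r is the product of a power of rho^2 with rho^{2i} r. *)
have rho2G : drot (1 + 1) \notin G.
  apply: contra tG => rG.
  have drotX m : (drot (1 + 1 : 'Z_n) ^+ m)%g = drot ((1 + 1) * m%:R).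
    elim: m => [|m IH]; first by rewrite mulr0.
    by rewrite expgS IH drotM -nat1r mulrDr mulr1.
  have -> : dref (t + t) = (drot (1 + 1) ^+ (t - i)%R * dref (i + i))%g.
    rewrite drotX drot_drefM natr_Zp; congr dref; ring.
  by rewrite groupM ?groupX.
have [] := @gx_cancel_div (N * e v) (N0 * e (v + 1)).
  rewrite -ref_coef_shift (@ref_coef_supp (v + 1 + 1)) ?mul0r ?subr0 //.
  apply: contra rho2G => v2G.
  have -> : drot (1 + 1) = (dref (v + 1 + 1 + i) * dref (v + i))%g.
    rewrite drefM; congr drot; ring.
  by rewrite groupM.
by move=> h ->; exists h.
Qed.

(** The coefficients of f on e_i R: the components of M / D at the images of i
    under the rotations, and of - N / D at those under the reflections. With
    these coefficients the other e_j R are sent to 0, so the sum over g computes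
    f(e_i b) from b itself, and columns can be added. *)
Lemma column_auslander (t : 'Z_n) : dref (t + t) \notin G ->
  exists al : dihedral n -> R, (forall g, g \notin G -> al g = 0) /\
    forall b, \sum_g al g * to g b = f (e i * b).
Proof.
move=> /ref_coef_div/choice[h hE].
pose nn := \sum_v h v; pose m := nn + f (e i).
have NE : N = nn * D by rewrite [N]mulr_sum_vtx mulr_suml; apply: eq_bigr.
have ME : M = m * D by rewrite mulrDl -NE column_vtx addrC subrK.
pose al (g : dihedral n) := if g.2 then - (nn * e (g.1 - i)) else m * e (g.1 + i).
exists al; split=> [[c []] /= gG | b].
- rewrite /al /=; apply/eqP; rewrite oppr_eq0; apply/eqP/D_reg.
  by rewrite -mulrA ev_xyn_comb mulrA -NE ref_coef_supp // subrK.
- rewrite /al /=; apply: D_reg.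
  by rewrite -mulrA ev_xyn_comb mulrA -ME rot_coef_supp // addrK.
have alE g j : al g * to g (e j) = if j == i then al g else 0.
  case: g => c []; rewrite (to_vtx toS) /al /= ?mulNr -mulrA vtx_mul.
    rewrite (inj_eq (addrI c)) eqr_opp [i == j]eq_sym.
    by case: eqP => [->|_]; rewrite ?mulr0 ?oppr0.
  rewrite (inj_eq (addrI c)) [i == j]eq_sym.
  by case: eqP => [->|_]; rewrite ?mulr0.
transitivity (\sum_g al g * to g (e i * b)).
  by apply: eq_bigr => g _; rewrite rmorphM /= mulrA alE eqxx.
rewrite vtx_vcoef sum_act_vtx; apply: D_regI; rewrite column_eq NE ME.
have [p ->] := dref_ev_ex (vcoef S i b).
have -> : rot_part al i = m.
  rewrite [RHS]mulr_sum_vtx (reindex_inj (addIr i)); apply: eq_bigr => c _ /=.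
  by rewrite /al /= -mulrA vtx_mul eqxx.
have -> : ref_part al i = - nn.
  rewrite [nn]mulr_sum_vtx (reindex_inj (addIr (- i))) -sumrN.
  apply: eq_bigr => c _ /=.
  by rewrite /al /= mulNr -mulrA vtx_mul eqxx.
by rewrite mulrDl mulNr -!mulrA ![D * _]ev_comm mulNr mulrA mulrA.
Qed.

End Column.

(** Add up the coefficients found for the e_i R. *)
Lemma auslander_surj (t : 'Z_n) : dref (t + t) \notin G ->
  forall F, exists z, auslander to G z = F.
Proof.
move=> tG F; have [FD FM] := right_endP F.
have /choice[al alE] := fun i => column_auslander i FD FM tG.
pose z : Defs.skew to G := [ffun g => \sum_i al i (sgval g)].
exists z; apply: right_end_ext => b; rewrite auslander_ext.
have -> : F b = \sum_i F (e i * b).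
  have F0 : F 0 = 0 by apply: (addrI (F 0)); rewrite -FD !addr0.
  by rewrite -(big_morph F FD F0) -mulr_suml vtx_sum mul1r.
under [RHS]eq_bigr => i _ do rewrite -(alE i).2.
rewrite exchange_big; apply: eq_bigr => g _; rewrite -mulr_suml; congr (_ * _).
rewrite /skew_ext; case: ifPn => gG; first by rewrite ffunE subgK.
by rewrite big1 // => i _; rewrite (alE i).1.
Qed.

Theorem auslander_bijP :
  bijective (auslander to G) <-> exists i, dref (i + i) \notin G.
Proof.
split=> [[h _ hK]|[i iG]].
  apply: contrapT => noref.
  have [|T noT] := auslander_not_surj; last by apply: (noT (h T)).
  move=> i; apply: contrapT => /negP iG; apply: noref; by exists i.
have [h hK] := choice (auslander_surj iG).
by exists h => // z; apply: auslander_inj; rewrite hK.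
Qed.

End AuslanderMap.

(** * The cyclic frame of the preprojective algebra *)
Section CyclicPreprojective.
Variables (k : fieldType) (n : nat).
Local Notation Q := (cyclic_quiver n).
Local Notation Q2 := (double_quiver Q).
Local Notation kQ2 := (path_algebra k Q2).
Local Notation R := (preproj k Q).
Local Notation e := (@pp_vertex k Q).
Local Notation al := (@pp_arrow k Q).
Local Notation als := (@pp_star k Q).
Implicit Types (i j v : 'Z_n) (a b : R).

Lemma pp_pathM (p q : qpath Q2) :
  (pp_path p : R) * pp_path q =
  if path_concat p q is Some s then pp_path s else 0.
Proof.
rewrite /pp_path -qpiM path_eltM /path_mul.
by case: (path_concat p q) => //; rewrite raddf0.
Qed.

Lemma vertex_path i (p : qpath Q2) :
  e i * pp_path p = if i == path_source p then pp_path p else 0.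
Proof.
rewrite pp_pathM concat_trivl -[eq_op i _]/(i == path_source p :> 'Z_n).
by case: eqP.
Qed.

Lemma path_vertex i (p : qpath Q2) :
  pp_path p * e i = if path_target p == i then pp_path p else 0.
Proof.
by rewrite pp_pathM concat_trivr; case: eqP.
Qed.

Lemma e_mul i j : e i * e j = if i == j then e j else 0.
Proof. exact: vertex_path. Qed.
Lemma e_al i j : e i * al j = if i == j then al j else 0.
Proof. exact: vertex_path. Qed.
Lemma e_als i j : e i * als j = if i == j + 1 then als j else 0.
Proof. exact: vertex_path. Qed.
Lemma al_e i j : al j * e i = if j + 1 == i then al j else 0.
Proof. exact: path_vertex. Qed.
Lemma als_e i j : als j * e i = if j == i then als j else 0.
Proof. exact: path_vertex. Qed.

Lemma sum_e : \sum_(i : 'Z_n) e i = 1.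
Proof.
rewrite -[1]/(qpi (Omega_ideal k Q) (pa_one k Q2)) /pa_one raddf_sum.
exact: eq_bigr.
Qed.

Definition ax : R := \sum_(i : 'Z_n) al i.
Definition ay : R := \sum_(i : 'Z_n) als i.

Lemma e_ax i : e i * ax = al i.
Proof.
rewrite mulr_sumr (bigD1 i) //= e_al eqxx big1 ?addr0 // => j ne.
by rewrite e_al eq_sym (negPf ne).
Qed.
Lemma ax_e i : ax * e (i + 1) = al i.
Proof.
rewrite mulr_suml (bigD1 i) //= al_e eqxx big1 ?addr0 // => j ne.
by rewrite al_e (inj_eq (addIr _)) (negPf ne).
Qed.
Lemma e_ay i : e (i + 1) * ay = als i.
Proof.
rewrite mulr_sumr (bigD1 i) //= e_als eqxx big1 ?addr0 // => j ne.
by rewrite e_als (inj_eq (addIr _)) eq_sym (negPf ne).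
Qed.
Lemma ay_e i : ay * e i = als i.
Proof.
rewrite mulr_suml (bigD1 i) //= als_e eqxx big1 ?addr0 // => j ne.
by rewrite als_e (negPf ne).
Qed.

(** Only composable arrows contribute to the two products, which makes this the
    relation Omega = 0. *)
Lemma ax_ay : ax * ay = ay * ax.
Proof.
apply/eqP; rewrite -subr_eq0; apply/eqP; rewrite -[RHS](pp_relation k Q).
rewrite big_split /= sumrN; congr (_ - _); rewrite [LHS]mulr_suml;
  apply: eq_bigr => i _.
- by rewrite -[als i]e_ay mulrA al_e eqxx.
- by rewrite -[al i]e_ax mulrA als_e eqxx.
Qed.

Lemma e_ax_comm i : e i * ax = ax * e (i + 1).
Proof. by rewrite e_ax ax_e. Qed.
Lemma ay_e_comm i : ay * e i = e (i + 1) * ay.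
Proof. by rewrite e_ay ay_e. Qed.

(** In a path, the only freedom after the start is the order of the starred and
    unstarred arrows, which is irrelevant in R. *)
Lemma pp_path_mono (p : qpath Q2) :
  exists c d, pp_path p = e (path_source p) * (ax ^+ c * ay ^+ d).
Proof.
case: p => -[v s] /= w; elim: s v w => [|b s IH] v w.
  exists 0, 0; rewrite !expr0 !mulr1; congr pp_path; exact: qpath_eq.
case/andP: (w) => /eqP ev ws; have [c [d E]] := IH _ ws.
have -> : pp_path (@QPath Q2 (v, b :: s) w) =
    pp_path (@arrow_path Q2 b) * pp_path (@QPath Q2 (target b, s) ws) :> R.
  rewrite pp_pathM; case: path_concatP => [r e1 e2 e3 _|/eqP//].
  by congr pp_path; apply: qpath_eq; rewrite ?e2 ?e3.
rewrite {}E /path_source /= {IH w ws}; case: b ev => i /= <-.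
- exists c.+1, d; rewrite -[pp_path _]/(al i) mulrA al_e eqxx -e_ax.
  by rewrite -mulrA exprS !mulrA.
- exists c, d.+1; rewrite -[pp_path _]/(als i) mulrA als_e eqxx -e_ay.
  rewrite -mulrA [ay * _]mulrA (commrX c (esym ax_ay)).
  by rewrite -mulrA -exprS.
Qed.

Lemma preproj_ind (P : R -> Prop) :
  (forall a b, P a -> P b -> P (a + b)) ->
  (forall t i c d, P (t *: (e i * (ax ^+ c * ay ^+ d)))) -> forall b, P b.
Proof.
move=> PD Pm b.
rewrite -(qreprK b) -[qpi _ _]scale1r.
elim/pa_ind: (qrepr b) 1 => [c f g IH IH'||p] t.
- rewrite raddfD /= qpiZ scalerDr scalerA; apply: PD; [exact: IH|exact: IH'].
- rewrite raddf0 scaler0 -(scale0r (e 0 * (ax ^+ 0 * ay ^+ 0))); exact: Pm.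
- have [c [d E]] := pp_path_mono p.
  by rewrite -[qpi _ _]/(pp_path p) E; apply: Pm.
Qed.

Local Notation P := {poly {poly k}}.

(** k[x,y] as a vector space over k. The alias is needed because {poly {poly k}}
    itself carries its module structure over {poly k}. *)
Definition bipoly := P.
HB.instance Definition _ := GRing.Zmodule.on bipoly.
Definition bscale (c : k) (p : bipoly) : bipoly := c%:P%:P * (p : P).
Lemma bscaleA c d p : bscale c (bscale d p) = bscale (c * d) p.
Proof. by rewrite /bscale mulrA !polyCM. Qed.
Lemma bscale1 : left_id 1 bscale.
Proof. by move=> p; rewrite /bscale mul1r. Qed.
Lemma bscaleDr : right_distributive bscale +%R.
Proof. by move=> c p q; rewrite /bscale mulrDr. Qed.
Lemma bscaleDl p : {morph bscale^~ p : c d / c + d}.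
Proof. by move=> c d; rewrite /bscale !polyCD mulrDl. Qed.
HB.instance Definition _ := GRing.Zmodule_isLmodule.Build k bipoly
  bscaleA bscale1 bscaleDr bscaleDl.

Definition arrow_mono (b : arrow Q2) : P := if b is inl _ then 'X else 'X%:P.

(** Arrows act on columns over k[x,y], indexed by the vertices, by x or y times
    elementary matrices. This is the coordinate at j of the image of the column
    of ones under a path; its linear extension vanishes on the ideal of Omega,
    hence gives functions on R. *)
Definition path_coef (j : 'Z_n) (p : qpath Q2) : bipoly :=
  if path_source p == j then \prod_(b <- path_arrows p) arrow_mono b else 0.

Definition pa_coef j (f : kQ2) : bipoly := lext (path_coef j) f.

Lemma pa_coef_linear j : linear (pa_coef j).
Proof. by move=> c f g; rewrite /pa_coef linearP. Qed.
HB.instance Definition _ j :=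
  GRing.isLinear.Build k kQ2 bipoly *:%R (pa_coef j) (pa_coef_linear j).

Lemma pa_coef_path j p : pa_coef j (path_elt p) = path_coef j p.
Proof. by rewrite /pa_coef path_elt.unlock lextU. Qed.

Lemma pa_coefM j p (z : kQ2) :
  pa_coef j (path_elt p * z) = path_coef j p * (pa_coef (path_target p) z : P).
Proof.
elim/pa_ind: z => [c f g IH IH'||q].
- rewrite mulrDr -scalerAr !linearP /= IH IH' mulrDr; congr (_ + _).
  rewrite -[_ *: _]/(bscale _ _) -[_ *: pa_coef _ f]/(bscale _ _) /bscale.
  by rewrite mulrCA.
- by rewrite mulr0 !linear0 mulr0.
rewrite path_eltM /path_mul pa_coef_path /path_coef.
case: path_concatP => [r e1 e2 e3 _|].
  rewrite pa_coef_path /path_coef e2 -e1 eqxx e3 big_cat /=.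
  by case: eqP => // _; rewrite mul0r.
by rewrite eq_sym linear0 => /negPf ->; rewrite mulr0.
Qed.

(** At the vertex j, the term alpha_j alpha_j^* and the term
    alpha_{j-1}^* alpha_{j-1} both act as x y. *)
Lemma pa_coef_Omega j z : pa_coef j (Omega k Q * z) = 0.
Proof.
rewrite mulr_suml raddf_sum /=.
have E i : pa_coef j ((@pa_arrow k Q (inl i) * @pa_arrow k Q (inr i) -
                      @pa_arrow k Q (inr i) * @pa_arrow k Q (inl i)) * z) =
   ((if i == j then 'X * 'X%:P * (pa_coef j z : P) else 0) -
   (if i + 1 == j then 'X * 'X%:P * (pa_coef j z : P) else 0) : P).
  rewrite mulrBl -!mulrA linearB /=; congr (_ - _).
    rewrite !pa_coefM /path_coef /path_target /path_source /= !eqxx.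
    by case: eqP => [->|]; rewrite ?mul0r // /path_arrows /= !big_seq1.
  rewrite !pa_coefM /path_coef /path_target /path_source /= !eqxx.
  by case: eqP => [->|]; rewrite ?mul0r // /path_arrows /= !big_seq1 mulrCA.
under eq_bigr do rewrite E.
rewrite big_split sumrN /= -!big_mkcond big_pred1_eq /=.
rewrite (big_pred1 (j - 1)) ?subrr // => i /=.
by rewrite [RHS]eq_sym subr_eq eq_sym.
Qed.

Lemma pa_coef_mull j u z : (forall i, pa_coef i z = 0) -> pa_coef j (u * z) = 0.
Proof.
move=> z0; elim/pa_ind: u => [c f g IH IH'||p].
- by rewrite mulrDl -scalerAl linearP /= IH IH' scaler0 addr0.
- by rewrite mul0r linear0.
- by rewrite pa_coefM z0 mulr0.
Qed.

Lemma pa_coef_ideal j z : z \in Omega_ideal k Q -> pa_coef j z = 0.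
Proof.
move=> /Omega_idealP[s ->]; rewrite linear_sum big1 // => u _ /=.
by rewrite -(mulrA u.1) pa_coef_mull // => i; exact: pa_coef_Omega.
Qed.

Definition pp_coef (j : 'Z_n) (b : R) : P := pa_coef j (qrepr b).

Lemma pp_coef_qpi j z : pp_coef j (qpi _ z) = pa_coef j z.
Proof.
apply/eqP; rewrite -subr_eq0 -(linearB (pa_coef j)) /= -opprB linearN oppr_eq0.
by apply/eqP/pa_coef_ideal; exact: qreprB.
Qed.

Lemma pp_coefB j : zmod_morphism (pp_coef j).
Proof.
by move=> a b; rewrite -(qreprK a) -(qreprK b) -raddfB !pp_coef_qpi linearB.
Qed.
HB.instance Definition _ j :=
  GRing.isZmodMorphism.Build R P (pp_coef j) (pp_coefB j).

Lemma pp_coef_scale j c b : pp_coef j (c *: b) = c%:P%:P * pp_coef j b.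
Proof. by rewrite -(qreprK b) -qpiZ !pp_coef_qpi linearZ. Qed.

Lemma pp_coef_path j p b :
  pp_coef j (pp_path p * b) = path_coef j p * pp_coef (path_target p) b.
Proof.
by rewrite -(qreprK b) /pp_path -qpiM !pp_coef_qpi pa_coefM.
Qed.

Lemma pp_coef_e j i b : pp_coef j (e i * b) = if i == j then pp_coef j b else 0.
Proof.
rewrite pp_coef_path /path_coef /= big_nil /path_target /=.
by case: eqP => [->|_]; rewrite ?mul1r ?mul0r.
Qed.

Lemma pp_coef_ax j b : pp_coef j (ax * b) = 'X * pp_coef (j + 1) b.
Proof.
rewrite mulr_suml raddf_sum (bigD1 j) //= pp_coef_path /path_coef /= eqxx big_seq1.
rewrite big1 ?addr0 // => i /negPf ne.
by rewrite pp_coef_path /path_coef /= -[eq_op _ _]/(i == j) ne mul0r.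
Qed.

Lemma pp_coef_ay j b : pp_coef j (ay * b) = 'X%:P * pp_coef (j - 1) b.
Proof.
rewrite mulr_suml raddf_sum (bigD1 (j - 1)) //= pp_coef_path /path_coef.
rewrite /path_source /path_target /= subrK eqxx /path_arrows /= big_seq1.
rewrite big1 ?addr0 // => i /negPf ne.
rewrite pp_coef_path /path_coef /path_source /=.
by rewrite -{1}[j](subrK 1) (inj_eq (addIr 1)) ne mul0r.
Qed.

Lemma pp_coef1 j : pp_coef j 1 = 1.
Proof.
have E i : pp_coef j (e i) = if i == j then 1 else 0.
  by rewrite pp_coef_qpi pa_coef_path /path_coef /= big_nil.
rewrite -sum_e raddf_sum (bigD1 j) //= E eqxx big1 ?addr0 // => i /negPf ne.
by rewrite E ne.
Qed.

Definition preproj_frame : cyclic_frame n R :=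
  CyclicFrame e_mul sum_e e_ax_comm ay_e_comm ax_ay preproj_ind
    pp_coefB pp_coef_scale pp_coef_e pp_coef_ax pp_coef_ay pp_coef1.

Lemma preproj_compat : dihedral_compat preproj_frame (dihedral_action k n).
Proof.
have rot_inj (c : 'Z_n) : injective (fun i : 'Z_n => c + i) by exact: addrI.
have ref_inj (c : 'Z_n) : injective (fun i : 'Z_n => c + (- i - 1)).
  by move=> i j /addrI/addIr/oppr_inj.
split=> [g i|g|g]; first exact: dihedral_map_e.
- transitivity (\sum_(i : 'Z_n) dihedral_map k g (al i)).
    exact: (raddf_sum (dihedral_map k g)).
  under eq_bigr do rewrite dihedral_map_al.
  case: g => c []; symmetry; [exact: (reindex_inj (ref_inj c))|].
  exact: (reindex_inj (rot_inj c)).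
- transitivity (\sum_(i : 'Z_n) dihedral_map k g (als i)).
    exact: (raddf_sum (dihedral_map k g)).
  under eq_bigr do rewrite dihedral_map_als.
  case: g => c []; symmetry; [exact: (reindex_inj (ref_inj c))|].
  exact: (reindex_inj (rot_inj c)).
Qed.

End CyclicPreprojective.

Theorem theorem1p2 (k : closedFieldType) (char_k : [pchar k] =i pred0)
    (n : nat) (n_ge3 : (3 <= n)%N) (G : {group dihedral n}) :
  bijective (auslander (dihedral_action k n) G) <->
  exists tau : dihedral n,
    [/\ is_reflection tau,
        exists i : vertex (cyclic_quiver n),
          dihedral_action k n tau (pp_vertex i) = pp_vertex i
      & tau \notin G].
Proof.
rewrite (auslander_bijP (preproj_compat k n) (ltnW n_ge3)); split.
  move=> [i iG]; exists (dref (i + i)); split=> //.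
    exists (i + i : 'Z_n).
    by rewrite d_rhoX natr_Zp drot_drefM addr0.
  by exists i; rewrite [LHS]dihedral_map_e /= addrK.
move=> [tau [[j ->] [i]]]; rewrite d_rhoX drot_drefM addr0.
rewrite [X in X = _]dihedral_map_e /= => /pp_vertex_inj E jG.
by exists i; rewrite -{1}E subrK.
Qed.
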